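(* Let $\mathfrak{G}$ be a presheaf of finite $p$-groups on $\mathscr{V}_f$. The following are equivalent: (1) $\mathfrak{G}$ is $p$-finite; (2) $\mathfrak{G}$ is polynomial; (3) both (a) there is $N$ such that $\Phi_N\mathfrak{G}$ is the trivial functor, and (b) each $\Phi_i\mathfrak{G}/\Phi_{i+1}\mathfrak{G}$ is a finite functor of $\mathscr{F}$; (4) $\mathfrak{G}$ has a composition series; (5) there is $d\in\mathbb{N}$ with $\gamma_{\mathfrak{G}}(t)=O(t^d)$. If moreover $\mathfrak{G}$ takes values in finite abelian $p$-groups, these conditions are also equivalent to: $\mathfrak{G}$ is a finite object (has a finite composition series) of the abelian category of functors from $\mathscr{V}_f^{\mathrm{op}}$ to finite abelian $p$-groups.
   Context: $p$ prime, $\mathbb{F}=\mathbb{F}_p$, $\mathscr{V}_f$ the category of finite-dimensional $\mathbb{F}$-vector spaces; a presheaf of finite $p$-groups is a functor $\mathscr{V}_f^{\mathrm{op}}\to$ (finite $p$-groups). $\mathscr{F}$ is the abelian category of functors $\mathscr{V}_f^{\mathrm{op}}\to$ ($\mathbb{F}$-vector spaces); a functor in $\mathscr{F}$ is finite if it has a finite composition series. For a finite $p$-group $G$, $\Phi G=[G,G]G^p$ is its Frattini subgroup; $\Phi_0G=G$, $\Phi_{n+1}G=\Phi(\Phi_nG)$. For a presheaf $\mathfrak{G}$, $\Phi_n\mathfrak{G}$ is the subpresheaf $V\mapsto\Phi_n(\mathfrak{G}(V))$, and $\Phi_n\mathfrak{G}/\Phi_{n+1}\mathfrak{G}$ takes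 values in finite-dimensional $\mathbb{F}$-vector spaces. $\mathfrak{G}$ is $p$-finite if $\bigoplus_{n\ge0}\Phi_n\mathfrak{G}/\Phi_{n+1}\mathfrak{G}$ (grading forgotten) is a finite functor of $\mathscr{F}$. Growth function: $\gamma_{\mathfrak{G}}(t)=\log_p|\mathfrak{G}(\mathbb{F}^t)|$. Polynomial (after Baues–Pirashvili): view $\mathfrak{G}$ as a covariant functor on $\mathscr{C}=\mathscr{V}_f^{\mathrm{op}}$ with monoidal structure $\oplus$ and unit $0$. Define $\mathrm{cr}_1\mathfrak{G}(V)=\ker(\mathfrak{G}(V)\to\mathfrak{G}(0))$ (map induced by $0\hookrightarrow V$), $\mathrm{cr}_2\mathfrak{G}(V,W)=\ker(\mathrm{cr}_1\mathfrak{G}(V\oplus W)\to\mathrm{cr}_1\mathfrak{G}(V)\times\mathrm{cr}_1\mathfrak{G}(W))$ (maps induced by the inclusions $V,W\hookrightarrow V\oplus W$), and recursively $\mathrm{cr}_{n+1}\mathfrak{G}(V_1,\dots,V_{n+1})=\mathrm{cr}_2(\mathrm{cr}_n\mathfrak{G}(-,V_3,\dots,V_{n+1}))(V_1,V_2)$. $\mathfrak{G}$ is polynomial of degree $\le n$ if $\mathrm{cr}_{n+1}\mathfrak{G}$ is trivial, and polynomial if it is polynomial of some degree. A composition series of $\mathfrak{G}$ means a finite chain of subpresheaves of groups $\{e\}=\mathfrak{G}_N\subset\dots\subset\mathfrak{G}_0=\mathfrak{G}$ with each $\mathfrak{G}_{i+1}$ normal in $\mathfrak{G}_i$ (sectionwise)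 and each quotient $\mathfrak{G}_i/\mathfrak{G}_{i+1}$ a simple object (non-trivial, with no proper non-trivial normal subpresheaves). *)

(* Defs.v *)
From HB Require Import structures.
From mathcomp Require Import all_boot all_order all_algebra all_fingroup all_solvable.
From mathcomp Require Import pgroup maximal.

Set Implicit Arguments.
Unset Strict Implicit.
Unset Printing Implicit Defensive.

Import GRing.Theory.

(* The category V_f of finite-dimensional F_p-vector spaces is replaced by its
   (equivalent) skeleton: objects are n : nat (standing for F_p^n), and a
   linear map F_p^m -> F_p^n is a matrix A : 'M['F_p]_(m,n) acting on row
   vectors (v |-> v *m A), so that composition "first A then B" is A *m B.
   A presheaf of finite p-groups is a contravariant functor: for each
   A : 'M_(m,n) a group homomorphism G n -> G m. *)
Record presheaf (p : nat) := Presheaf {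
  ps_obj :> nat -> finGroupType;
  ps_act : forall m n : nat, 'M['F_p]_(m, n) -> ps_obj n -> ps_obj m;
  ps_actM : forall m n (A : 'M['F_p]_(m, n)) (x y : ps_obj n),
      ps_act A (x * y)%g = (ps_act A x * ps_act A y)%g;
  ps_act1 : forall n (x : ps_obj n), ps_act (1%:M)%R x = x;
  ps_actC : forall k m n (A : 'M['F_p]_(k, m)) (B : 'M['F_p]_(m, n)) x,
      ps_act (A *m B)%R x = ps_act A (ps_act B x);
  ps_pgroup : forall n, (p.-group [set: ps_obj n])%g
}.

Arguments ps_act {p} _ {m n} _ _.

Local Open Scope group_scope.

Section Presheaves.
Variables (p : nat) (G : presheaf p).

Definition subps (H : forall n, {group G n}) : Prop :=
  forall m n (A : 'M['F_p]_(m, n)) (x : G n), x \in H n -> ps_act G A x \in H m.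

Definition eqfam (H K : forall n, {group G n}) : Prop := forall n, H n :=: K n.

Definition topfam : forall n, {group G n} := fun n => [set: G n]%G.
Definition botfam : forall n, {group G n} := fun n => 1%G.

Definition Phin (k : nat) : forall n, {group G n} :=
  fun n => iter k (fun H : {group G n} => 'Phi(H)%G) [set: G n]%G.

Definition growth (t : nat) : nat := logn p #|[set: G t]|.

Definition growth_poly_bounded : Prop :=
  exists d C T : nat, forall t, T <= t -> growth t <= C * t ^ d.

Fixpoint dimc (a : nat) (s : seq nat) : nat :=
  if s is b :: s' then dimc (a + b) s' else a.

Fixpoint extm (s : seq nat) (m n : nat) (A : 'M['F_p]_(m, n))
    : 'M['F_p]_(dimc m s, dimc n s) :=
  match s return 'M['F_p]_(dimc m s, dimc n s) with
  | [::] => A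
  | b :: s' => extm s' (block_mx A 0 0 1%:M)%R
  end.

(* cr G s a = cr_{1 + size s} G (a, b1, ..., bk) for s = [:: b1; ...; bk],
   a subgroup of G(a (+) b1 (+) ... (+) bk), defined by the recursion
   cr_{n+1} G (V1, V2, rest) = cr_2 (cr_n G (-, rest)) (V1, V2). *)
Fixpoint cr (s : seq nat) (a : nat) : {set G (dimc a s)} :=
  match s return {set G (dimc a s)} with
  | [::] => [set x : G a | ps_act G (0%R : 'M['F_p]_(0, a)) x == 1]
  | b :: s' =>
      [set x in cr s' (a + b) |
        (ps_act G (extm s' (row_mx 1%:M 0 : 'M['F_p]_(a, a + b))%R) x == 1)
        && (ps_act G (extm s' (row_mx 0 1%:M : 'M['F_p]_(b, a + b))%R) x == 1)]
  end.

Definition poly_deg_le (n : nat) : Prop :=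
  forall (s : seq nat) (a : nat), size s = n -> cr s a = 1.

Definition is_polynomial : Prop := exists n, poly_deg_le n.

(* Normal subpresheaves of the quotient L_j / L_{j+1} correspond to
   subpresheaves M with L_{j+1} <= M and M normal in L_j. *)
Definition comp_series : Prop :=
  exists (N : nat) (L : nat -> forall n, {group G n}),
  [/\ eqfam (L 0) topfam, eqfam (L N) botfam,
      forall j, j <= N -> subps (L j) &
      forall j, j < N ->
        [/\ forall n, L j.+1 n <| L j n,
            exists n, L j.+1 n != L j n &
            forall M : forall n, {group G n}, subps M ->
              (forall n, L j.+1 n \subset M n) -> (forall n, M n <| L j n) ->
              eqfam M (L j.+1) \/ eqfam M (L j)]].

(* For a section H/K (K <= H subpresheaves, H/K abelian), sub-objects of
   H/K correspond to subpresheaves M with K <= M <= H.  H/K has finite length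
   iff there is a chain H = L_0 >= ... >= L_N = K of subpresheaves with
   simple successive quotients (non-zero, no intermediate subpresheaf).
   Used both for objects of F (the values Phi_i/Phi_{i+1} are elementary
   abelian p-groups, whose subgroups are exactly the F_p-subspaces) and for
   the category of functors to finite abelian p-groups. *)
Definition finite_section (H K : forall n, {group G n}) : Prop :=
  exists (N : nat) (L : nat -> forall n, {group G n}),
  [/\ eqfam (L 0) H, eqfam (L N) K,
      forall j, j <= N -> subps (L j) &
      forall j, j < N ->
        [/\ forall n, L j.+1 n \subset L j n,
            exists n, L j.+1 n != L j n &
            forall M : forall n, {group G n}, subps M ->
              (forall n, L j.+1 n \subset M n) -> (forall n, M n \subset L j n) ->
              eqfam M (L j.+1) \/ eqfam M (L j)]].

(* An element of ((+)_k Phi_k/Phi_{k+1})(F^n) is represented by a sequence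
   x : nat -> G n with x k in Phi_k, almost all x k in Phi_{k+1}; two
   representatives are identified when they agree modulo Phi_{k+1} in each
   degree.  The group law (addition of the F_p-vector space) is the
   componentwise product.  A subfunctor is a predicate on representatives
   that is saturated, a subgroup, and stable under the structure maps. *)
Definition gel (n : nat) (x : nat -> G n) : Prop :=
  (forall k, x k \in Phin k n) /\
  (exists M, forall k, M <= k -> x k \in Phin k.+1 n).

Definition gzero (n : nat) (x : nat -> G n) : Prop :=
  gel x /\ forall k, x k \in Phin k.+1 n.

Definition gsub (S : forall n, (nat -> G n) -> Prop) : Prop :=
  [/\ forall n x, S n x -> gel x,
      forall n, S n (fun _ => 1),
      forall n x y, S n x -> S n y -> S n (fun k => x k * y k),
      forall n x, S n x -> S n (fun k => (x k)^-1) &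
      (forall n x y, S n x -> gel y ->
         (forall k, x k * (y k)^-1 \in Phin k.+1 n) -> S n y) /\
      (forall m n (A : 'M['F_p]_(m, n)) x, S n x -> S m (fun k => ps_act G A (x k)))].

Definition gincl (S T : forall n, (nat -> G n) -> Prop) : Prop :=
  forall n x, S n x -> T n x.
Definition geq (S T : forall n, (nat -> G n) -> Prop) : Prop :=
  forall n x, S n x <-> T n x.

(* p-finite: (+)_k Phi_k G / Phi_{k+1} G is a finite functor of F, i.e. has a
   finite composition series (simple quotients = non-zero, no intermediate
   subfunctor). *)
Definition p_finite : Prop :=
  exists (N : nat) (S : nat -> forall n, (nat -> G n) -> Prop),
  [/\ geq (S 0) gel, geq (S N) gzero,
      forall j, j <= N -> gsub (S j) &
      forall j, j < N ->
        [/\ gincl (S j.+1) (S j),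
            exists n x, S j n x /\ ~ S j.+1 n x &
            forall T, gsub T -> gincl (S j.+1) T -> gincl T (S j) ->
              geq T (S j.+1) \/ geq T (S j)]].

Definition cond3 : Prop :=
  (exists N, eqfam (Phin N) botfam) /\
  (forall i, finite_section (Phin i) (Phin i.+1)).

End Presheaves.

(* Main.v *)
Require Import Defs.
From HB Require Import structures.
From mathcomp Require Import all_boot all_order all_algebra all_fingroup all_solvable.
From Stdlib Require Import Classical ClassicalEpsilon FunctionalExtensionality.
From mathcomp Require Import mxabelem.

(** Every condition is shown to be equivalent to the vanishing of the cross
    effects of G on copies of the line F_p beyond some rank n ([cross_vanish]).

    If they vanish, the identity of G(F^t) is a group word in the operations
    induced by the coordinate projections of rank at most n. So a subpresheaf is
    determined by its value at F^n: strict chains have bounded length, which gives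
    all the composition series, and an element of G(F^t) is determined by its
    restrictions to the coordinate subspaces of rank at most n, which bounds the
    growth. Conversely a non-trivial cross effect of rank k yields at least
    2^(m^k) elements of G(F^(tm)), for a fixed t, which forbids slow growth.

    For the composition series, one has to kill the cross effects of large rank of
    a simple section H/K. It has elementary abelian values. Choose m with
    H(F^m) <> K(F^m). The x in H(F^t) for which A |-> A^* x, from M_(m,t) to
    H(F^m)/K(F^m), is a function of degree < k, in the sense of iterated finite
    differences, form a subpresheaf. It is K for k = 0, and for k large it is all
    of H: at t = m, because the augmentation ideal of the group algebra over F_p of
    the finite p-group M_(m,m) is nilpotent, hence everywhere by simplicity. *)

Set Implicit Arguments.
Unset Strict Implicit.
Unset Printing Implicit Defensive.

Import GRing.Theory.

(** * Cross effects on lines *)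

Section CoordinateMatrices.

Variable p : nat.
Local Open Scope ring_scope.

(** The diagonal idempotent that projects [F_p^t] onto the coordinate subspace indexed by [S]. *)
Definition dg t (S : {set 'I_t}) : 'M['F_p]_t :=
  \matrix_(i, j) ((i == j) && (i \in S))%:R.

Lemma mul_dg_mx t m (S : {set 'I_t}) (A : 'M['F_p]_(t, m)) i j :
  (dg S *m A) i j = (i \in S)%:R * A i j.
Proof.
rewrite mxE (bigD1 i) //= mxE eqxx /= big1 ?addr0 // => l /negPf lj.
by rewrite mxE eq_sym lj mul0r.
Qed.

Lemma dgI t (S T : {set 'I_t}) : dg S *m dg T = dg (S :&: T).
Proof.
apply/matrixP=> i j; rewrite mul_dg_mx !mxE in_setI -natrM mulnb.
by rewrite andbCA.
Qed.

Lemma dg_setT t : dg [set: 'I_t] = 1%:M.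
Proof. by apply/matrixP=> i j; rewrite !mxE in_setT andbT. Qed.

Lemma dg_setU1 t (S : {set 'I_t}) i :
  i \notin S -> dg (i |: S) = dg S + dg [set i].
Proof.
move=> iS; apply/matrixP=> j l; rewrite !mxE !inE.
case: (j == l) => //=; last by rewrite addr0.
case: eqVneq => [->|_] /=; first by rewrite (negPf iS) add0r.
by rewrite addr0.
Qed.

(** The value [None] gives a zero row, so coordinate subspaces of rank smaller than [n] are reached
    as well. *)
Definition sel n t (f : {ffun 'I_n -> option 'I_t}) : 'M['F_p]_(n, t) :=
  \matrix_(i, j) (f i == Some j)%:R.

Lemma dg_factor n t (S : {set 'I_t}) :
  (#|S| <= n)%N -> exists A f, dg S = A *m @sel n t f.
Proof.
move=> Sn; pose f := [ffun i : 'I_n => onth (enum S) i].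
pose A : 'M['F_p]_(t, n) :=
  \matrix_(j, i) ((j \in S) && (index j (enum S) == i :> nat))%:R.
exists A, f; apply/matrixP=> j l; rewrite !mxE.
have [jS|jS] := boolP (j \in S); last first.
  rewrite andbF big1 // => i _; rewrite !mxE (negPf jS) mul0r //.
have lt_j : (index j (enum S) < n)%N.
  by apply: leq_trans Sn; rewrite cardE index_mem mem_enum.
rewrite (bigD1 (Ordinal lt_j)) //= !mxE jS eqxx mul1r ffunE /=.
rewrite onthE (nth_map j) ?index_mem ?mem_enum // nth_index ?mem_enum //.
rewrite big1 ?addr0 ?andbT // => i ij; rewrite !mxE jS /=.
have /negPf -> : index j (enum S) != i; last by rewrite mul0r.
by apply: contra ij => /eqP e; apply/eqP/val_inj.
Qed.

End CoordinateMatrices.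

Section CrossEffects.

Variables (p : nat) (G : presheaf p).
Local Open Scope group_scope.
Local Notation act := (ps_act G).

Lemma ps_act_one m n (A : 'M['F_p]_(m, n)) : act A 1 = 1.
Proof. by apply: (mulgI (act A 1)); rewrite -ps_actM !mulg1. Qed.

Lemma ps_actV m n (A : 'M['F_p]_(m, n)) x : act A x^-1 = (act A x)^-1.
Proof. by apply: (mulgI (act A x)); rewrite -ps_actM !mulgV ps_act_one. Qed.

Lemma subps_top : subps (@topfam p G).
Proof. by move=> m n A x _; rewrite inE. Qed.

Lemma subps_bot : subps (@botfam p G).
Proof. by move=> m n A x /set1gP ->; rewrite ps_act_one group1. Qed.

(** The cross effect of [G] on the lines indexed by [S], realised inside [G t]: elements coming from
    [F_p^S] that die on every coordinate subspace missing one of these lines. *)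
Definition cross t (S : {set 'I_t}) (z : G t) : Prop :=
  act (dg p S) z = z /\
  forall U : {set 'I_t}, ~~ (S \subset U) -> act (dg p U) z = 1.

Definition cross_vanish (n : nat) : Prop :=
  forall t (S : {set 'I_t}) z, n < #|S| -> cross S z -> z = 1.

Lemma crossI t (S : {set 'I_t}) z :
  act (dg p S) z = z -> (forall i, i \in S -> act (dg p (~: [set i])) z = 1) ->
  cross S z.
Proof.
move=> zS zi; split=> // U /subsetPn[i iS iU].
have -> : dg p U = (dg p U *m dg p (~: [set i]))%R.
  rewrite dgI; congr dg; apply/setP=> j; rewrite !inE.
  by case: eqVneq => [->|]; rewrite ?(negPf iU) ?andbT.
by rewrite ps_actC zi // ps_act_one.
Qed.

(** Group words in the projections [dg U] with [Q U]. As words they preserve every subpresheaf, even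
    though they need not be homomorphisms. *)
Inductive natop t (Q : {set 'I_t} -> Prop) : (G t -> G t) -> Prop :=
| natop_dg U : Q U -> natop Q (act (dg p U))
| natop_one : natop Q (fun _ => 1)
| natop_mul f g : natop Q f -> natop Q g -> natop Q (fun x => f x * g x)
| natop_inv f : natop Q f -> natop Q (fun x => (f x)^-1).

Lemma natop_ext t (Q : {set 'I_t} -> Prop) f g :
  f =1 g -> natop Q f -> natop Q g.
Proof. by move=> /functional_extensionality ->. Qed.

Lemma natop_restrict t (Q : {set 'I_t} -> Prop) V f :
  (forall U, Q U -> Q (V :&: U)) -> natop Q f ->
  natop Q (fun x => act (dg p V) (f x)).
Proof.
move=> QI; elim=> {f} [U QU||f g _ IHf _ IHg|f _ IHf].
- apply: (@natop_ext _ _ (act (dg p (V :&: U)))) => [x|].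
    by rewrite -dgI ps_actC.
  by apply: natop_dg; apply: QI.
- by apply: natop_ext (natop_one _) => x; rewrite ps_act_one.
- by apply: natop_ext (natop_mul IHf IHg) => x; rewrite ps_actM.
- by apply: natop_ext (natop_inv IHf) => x; rewrite ps_actV.
Qed.

Lemma natop_trans t (Q Q' : {set 'I_t} -> Prop) f :
  (forall U, Q U -> natop Q' (act (dg p U))) -> natop Q f -> natop Q' f.
Proof.
move=> QQ'; elim=> {f} [U /QQ' //||f g _ IHf _ IHg|f _ IHf].
- exact: natop_one.
- exact: natop_mul.
- exact: natop_inv.
Qed.

Definition devi t (i : 'I_t) (x : G t) : G t := x * (act (dg p (~: [set i])) x)^-1.

Lemma act_devi t (V : {set 'I_t}) i x :
  act (dg p V) (devi i x) = devi i (act (dg p V) x).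
Proof. by rewrite /devi ps_actM ps_actV -!ps_actC !dgI setIC. Qed.

Lemma devi_id t (i : 'I_t) x : act (dg p (~: [set i])) (devi i x) = 1.
Proof. by rewrite /devi ps_actM ps_actV -ps_actC dgI setIid mulgV. Qed.

Lemma devi1 t (i : 'I_t) : devi i (1 : G t) = 1.
Proof. by rewrite /devi ps_act_one mulgV. Qed.

(** The operators [devi i] need not commute with each other, but each commutes with all projections.
    So the vanishing created by one of them survives the later ones. *)
Lemma cross_devi t (S : {set 'I_t}) x :
  cross S (foldr (@devi t) (act (dg p S) x) (enum S)).
Proof.
have fix_foldr s : act (dg p S) (foldr (@devi t) (act (dg p S) x) s)
    = foldr (@devi t) (act (dg p S) x) s.
  by elim: s => [|i s IHs] /=; rewrite -?ps_actC ?dgI ?setIid // act_devi IHs.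
apply: crossI => // i; rewrite -mem_enum.
elim: (enum S) => // j s IHs; rewrite inE => /predU1P[->|/IHs e] /=.
  exact: devi_id.
by rewrite act_devi e devi1.
Qed.

(** Expanding the deviations as in inclusion-exclusion leaves the projection onto [S] as leading
    factor; every other factor involves a proper subset of [S]. *)
Lemma natop_devi t (S : {set 'I_t}) s : {subset s <= S} ->
  exists2 f, natop (fun U => U \proper S) f &
    forall x, foldr (@devi t) (act (dg p S) x) s = act (dg p S) x * f x.
Proof.
elim: s => [|i s IHs] sS /=.
  by exists (fun _ => 1) => [|x]; [exact: natop_one | rewrite mulg1].
have [j js|f nf fE] := IHs; first by apply: sS; rewrite inE js orbT.
have iS : i \in S by apply: sS; rewrite mem_head.
exists (fun x => f x * ((act (dg p (~: [set i])) (f x))^-1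
                       * (act (dg p (~: [set i] :&: S)) x)^-1)).
  apply: natop_mul => //; apply: natop_mul; apply: natop_inv.
    apply: natop_restrict => // U; apply: sub_proper_trans; exact: subsetIr.
  apply: natop_dg; rewrite properEneq subsetIr andbT.
  by apply: contraTneq iS => <-; rewrite !inE eqxx.
by move=> x; rewrite fE /devi ps_actM -ps_actC dgI invMg !mulgA.
Qed.

(** Induction on the rank: above [n] the iterated deviation is a cross effect, hence trivial, and
    this expresses the projection onto [S] by those onto proper subsets. *)
Lemma natop_id n t : cross_vanish n ->
  natop (fun U : {set 'I_t} => #|U| <= n) id.
Proof.
move=> vG; suff H (S : {set 'I_t}) : natop (fun U => #|U| <= n) (act (dg p S)).
  by apply: natop_ext (H [set: _]) => x; rewrite dg_setT ps_act1.
have [k] := ubnP #|S|; elim: k S => // k IHk S leSk.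
have [leSn|ltnS_] := leqP #|S| n; first exact: natop_dg.
have [i|f nf fE] := @natop_devi t S (enum S); first by rewrite mem_enum.
have -> : act (dg p S) = fun x => (f x)^-1.
  apply: functional_extensionality => x; apply/eqP; rewrite eq_mulgV1 invgK.
  by rewrite -fE; apply/eqP/(vG _ _ _ ltnS_)/cross_devi.
apply: natop_inv; apply: natop_trans nf => U /proper_card ltUS.
by apply: IHk; apply: leq_trans ltUS _.
Qed.

Lemma detection_dg n t (K : {group G t}) (x : G t) :
  cross_vanish n -> (forall U : {set 'I_t}, #|U| <= n -> act (dg p U) x \in K) -> x \in K.
Proof.
move=> /(@natop_id n t) nG xK; change (id x \in K).
elim: nG => [U /xK||f g _ IHf _ IHg|f _ IHf] //.
- exact: groupM.
- by rewrite groupV.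
Qed.

(** A projection of rank at most [n] factors through [F_p^n], so membership in a subpresheaf is
    decided by the restrictions to [F_p^n]. *)
Lemma detection n t (K : forall n, {group G n}) (x : G t) :
  cross_vanish n -> subps K ->
  (forall f, act (sel p f : 'M_(n, t)) x \in K n) -> x \in K t.
Proof.
move=> vG sK xK; apply: detection_dg vG _ => U /(@dg_factor p)[A [f ->]].
by rewrite ps_actC; apply: sK.
Qed.

Lemma detection_eq n (H K : forall n, {group G n}) :
  cross_vanish n -> subps H -> subps K -> (forall t, K t \subset H t) ->
  #|H n| <= #|K n| -> eqfam K H.
Proof.
move=> vG sH sK KH leHK t.
have eqn : K n :=: H n by apply/eqP; rewrite eqEcard KH.
apply/eqP; rewrite eqEsubset KH; apply/subsetP => x xH.
by apply: detection vG sK _ => f; rewrite eqn; apply: sH.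
Qed.

End CrossEffects.

(** * Block cross effects *)

Section BlockMatrices.

Variable p : nat.
Local Open Scope ring_scope.

(** The map [F_p^m (+) F_p^t (+) ... (+) F_p^t -> F_p^t] given by [A] on the first summand and by
    the projections onto the lines of [s] on the others. The first block grows along the recursion
    exactly as in [dimc] and [extm]. *)
Fixpoint stack t (s : seq 'I_t) m (A : 'M['F_p]_(m, t)) :
    'M['F_p]_(dimc m [seq t | _ <- s], t) :=
  match s return 'M['F_p]_(dimc m [seq t | _ <- s], t) with
  | [::] => A
  | i :: s' => stack s' (col_mx A (dg p [set i]))
  end.

Lemma extm_stack t (s : seq 'I_t) m n (M : 'M['F_p]_(m, n))
    (A : 'M['F_p]_(n, t)) :
  extm [seq t | _ <- s] M *m stack s A = stack s (M *m A).
Proof.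
elim: s m n M A => [|i s IHs] m n M A //=.
by rewrite IHs mul_block_col !mul0mx mul1mx add0r addr0.
Qed.

Lemma stack_dg t (s : seq 'I_t) m (A : 'M['F_p]_(m, t)) (T : {set 'I_t}) :
  A = A *m dg p T -> stack s A = stack s A *m dg p (T :|: [set i in s]).
Proof.
elim: s m A T => [|i s IHs] m A T AT /=.
  by rewrite {1}AT; congr (_ *m dg p _); apply/setP=> j; rewrite !inE orbF.
rewrite {1}(IHs _ _ (T :|: [set i])); last first.
  rewrite mul_col_mx dgI; congr col_mx.
    by rewrite {2}AT -mulmxA dgI setIUr setIid (setUidPl (subsetIl _ _)).
  by congr (dg p _); apply/setP=> j; rewrite !inE; case: eqP; rewrite ?orbT.
by congr (_ *m dg p _); apply/setP=> j; rewrite !inE orbA.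
Qed.

Lemma sub_stack t (s : seq 'I_t) m (A : 'M['F_p]_(m, t)) :
  (A <= stack s A)%MS /\ (forall i, i \in s -> (dg p [set i] <= stack s A)%MS).
Proof.
elim: s m A => [|j s IHs] m A //=.
have [Asub ssub] := IHs _ (col_mx A (dg p [set j])); move: Asub.
rewrite -addsmxE addsmx_sub => /andP[Asub jsub]; split=> // i.
by rewrite inE => /predU1P[->|/ssub].
Qed.

Lemma extmM s m n k (A : 'M['F_p]_(m, n)) (B : 'M['F_p]_(n, k)) :
  extm s (A *m B) = extm s A *m extm s B.
Proof.
elim: s m n k A B => [|b s IHs] m n k A B //=.
by rewrite -IHs mulmx_block !mul0mx !mulmx0 mul1mx !addr0 add0r.
Qed.

(* [colour s c i] tells in which summand of a + b1 + ... + bk the coordinate i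
   lies: b_j gets the colour k + 1 - j and c colours the coordinates of a. *)
Fixpoint colour (s : seq nat) a (c : 'I_a -> nat) : 'I_(dimc a s) -> nat :=
  match s return 'I_(dimc a s) -> nat with
  | [::] => c
  | b :: s' => colour (s := s') (a := a + b)
      (fun i => if split i is inl i then c i else (size s').+1)
  end.

(** [extm] is the identity on the added summands, whose colours all satisfy [Q]; only the first
    block is really projected. *)
Lemma dg_colour s a (c : 'I_a -> nat) (Q : pred nat) :
  (forall j, (0 < j <= size s)%N -> Q j) ->
  dg p [set i | Q (colour (s := s) c i)] = extm s (dg p [set i | Q (c i)]).
Proof.
elim: s a c => [|b s IHs] a c Qs //=; rewrite IHs; last first.
  by move=> j /andP[j0 js]; apply: Qs; rewrite j0 (leqW js).
congr extm; apply/matrixP=> i j; rewrite mxE inE.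
case: (split_ordP i) => i' ->; case: (split_ordP j) => j' ->;
  rewrite ?(unsplitK (inl _)) ?(unsplitK (inr _)).
- by rewrite block_mxEul mxE inE eq_lshift.
- by rewrite block_mxEur mxE eq_lrshift.
- by rewrite block_mxEdl mxE eq_rlshift.
- by rewrite block_mxEdr mxE eq_rshift Qs ?andbT //= ltnS leqnn.
Qed.

Lemma dg_lshift a b :
  dg p [set i : 'I_(a + b) | if split i is inl _ then true else false]
  = (col_mx 1%:M 0 : 'M_(a + b, a)) *m row_mx 1%:M 0.
Proof.
apply/matrixP=> i j; rewrite mul_col_row !mul1mx !mul0mx mxE inE.
case: (split_ordP i) => i' ->; case: (split_ordP j) => j' ->;
  rewrite ?(unsplitK (inl _)) ?(unsplitK (inr _)).
- by rewrite block_mxEul mxE eq_lshift ?andbT ?andbF.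
- by rewrite block_mxEur mxE eq_lrshift.
- by rewrite block_mxEdl mxE eq_rlshift.
- by rewrite block_mxEdr mxE eq_rshift ?andbT ?andbF.
Qed.

Lemma dg_rshift a b :
  dg p [set i : 'I_(a + b) | if split i is inl _ then false else true]
  = (col_mx 0 1%:M : 'M_(a + b, b)) *m row_mx 0 1%:M.
Proof.
apply/matrixP=> i j; rewrite mul_col_row !mul1mx !mul0mx mxE inE.
case: (split_ordP i) => i' ->; case: (split_ordP j) => j' ->;
  rewrite ?(unsplitK (inl _)) ?(unsplitK (inr _)).
- by rewrite block_mxEul mxE eq_lshift ?andbT ?andbF.
- by rewrite block_mxEur mxE eq_lrshift.
- by rewrite block_mxEdl mxE eq_rlshift.
- by rewrite block_mxEdr mxE eq_rshift ?andbT ?andbF.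
Qed.

End BlockMatrices.

(** * Polynomial degree and vanishing of the cross effects on lines *)

Section PolynomialDegree.

Variables (p : nat) (G : presheaf p).
Local Open Scope group_scope.
Local Notation act := (ps_act G).

Lemma cross_kill t m (S U : {set 'I_t}) z (A : 'M['F_p]_(m, t)) i :
  cross S z -> A = (A *m dg p U)%R -> i \in S -> i \notin U -> act A z = 1.
Proof.
move=> [_ zU] -> iS iU; rewrite ps_actC zU ?ps_act_one //.
by apply/subsetPn; exists i.
Qed.

(** The first block carries the line [i0] and each further block one line of [s]. Dropping the block
    of [i] loses the line [i], and dropping the first block loses [i0]; either way [z] is killed. *)
Lemma stack_cr t (S T : {set 'I_t}) z (s : seq 'I_t) m (A : 'M['F_p]_(m, t)) i0 :
  cross S z -> i0 \in S -> i0 \in T -> i0 \notin s -> uniq s ->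
  {subset s <= S} -> {in s, forall i, i \notin T} -> A = (A *m dg p T)%R ->
  act (stack s A) z \in cr G [seq t | _ <- s] m.
Proof.
move=> cz i0S; elim: s m A T => [|i s IHs] m A T i0T i0s us sS sT AT /=.
  rewrite inE -ps_actC mul0mx; apply/eqP.
  by apply: (cross_kill (U := set0) cz _ i0S); rewrite ?inE ?mul0mx.
move: i0s us; rewrite inE negb_or => /andP[i0i i0s] /= /andP[i_s us].
have iS : i \in S by rewrite sS ?mem_head.
rewrite inE -!ps_actC !extm_stack !mul_row_col !mul0mx !mul1mx addr0 add0r.
apply/and3P; split.
- apply: (IHs _ _ (i |: T)) => //.
  + by rewrite !inE i0T orbT.
  + by move=> j js; rewrite sS // inE js orbT.
  + move=> j js; rewrite !inE negb_or sT ?inE ?js ?orbT // andbT.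
    by apply: contraNneq i_s => <-.
  + rewrite mul_col_mx dgI; congr col_mx.
      by rewrite {2}AT -mulmxA dgI setIUr setIid (setUidPr (subsetIl _ _)).
    by congr (dg p _); apply/setP=> j; rewrite !inE; case: eqP.
- apply/eqP/(cross_kill cz (stack_dg s AT) iS).
  by rewrite !inE (negPf i_s) orbF sT ?mem_head.
- apply/eqP/(cross_kill cz (stack_dg (T := [set i]) s _) i0S).
    by rewrite dgI setIid.
  by rewrite !inE (negPf i0i) (negPf i0s).
Qed.

Lemma poly_deg_le_cross_vanish n : poly_deg_le G n -> cross_vanish G n.
Proof.
move=> pG t S z ltnS cz.
have [i0 i0S] : exists i0, i0 \in S by apply/set0Pn; rewrite -card_gt0 (leq_trans _ ltnS).
pose s := take n (enum (S :\ i0)).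
have sE i : i \in s -> i \in S :\ i0 by move/mem_take; rewrite mem_enum.
have us : uniq s by rewrite take_uniq ?enum_uniq.
have szs : size s = n.
  rewrite size_takel // -cardE; move: ltnS; rewrite (cardsD1 i0) i0S //.
have i0s : i0 \notin s by apply/negP => /sE; rewrite !inE eqxx.
(* The [n] lines of [s] get one block each, and the first block takes all the remaining lines of
   [S], among them [i0]. *)
pose T := S :\: [set i in s].
have := @stack_cr t S T z s t (dg p T) i0 cz i0S.
rewrite pG ?size_map // => /(_ _ i0s us) => z1.
have {z1} /set1gP z1 : act (stack s (dg p T)) z \in [1].
  apply: z1; rewrite ?inE ?i0s //.
  - by move=> i /sE /setD1P[].
  - by move=> i is_; rewrite !inE is_.
  - by rewrite dgI setIid.
(* If [dg p S] factors through the stacked matrix, then [z], being fixed by [dg p S], is an image of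
   the trivial element. *)
suff /submxP[J SJ] : (dg p S <= stack s (dg p T))%MS.
  by have [<- _] := cz; rewrite SJ ps_actC z1 ps_act_one.
have [Tsub ssub] := sub_stack s (dg p T).
apply/row_subP => i; have [iS|iS] := boolP (i \in S); last first.
  rewrite (_ : row i _ = 0%R) ?sub0mx //; apply/rowP => j.
  by rewrite !mxE (negPf iS) andbF.
have [is_|is_] := boolP (i \in s).
  rewrite (_ : row i _ = row i (dg p [set i])) ?(submx_trans (row_sub _ _)) ?ssub //.
  by apply/rowP => j; rewrite !mxE !inE iS eqxx.
rewrite (_ : row i _ = row i (dg p T)) ?(submx_trans (row_sub _ _)) //.
by apply/rowP => j; rewrite !mxE !inE iS is_.
Qed.

(** Omitting one added summand kills an element of [cr]. The colouring [c] of the first block is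
    kept general because the recursion merges the summands already treated into that block. *)
Lemma cr_colour s a (c : 'I_a -> nat) x j :
  x \in cr G s a -> 0 < j <= size s -> (forall i, ~~ (0 < c i <= size s)) ->
  act (dg p [set i | colour (s := s) c i != j]) x = 1.
Proof.
elim: s a c x => [|b s IHs] a c x; first by move=> _ /andP[/leq_trans h /h].
rewrite /= inE => /and3P[xs /eqP xa /eqP xb] jP cP.
have [jE|js] := eqVneq j (size s).+1.
  rewrite (@dg_colour p s _ _ [pred l | l != j]) => [|l /andP[_ ls]] /=; last first.
    by rewrite jE neq_ltn ltnS ls.
  rewrite (_ : dg p _ =
      dg p [set i : 'I_(a + b) | if split i is inl _ then true else false]).
    by rewrite dg_lshift extmM ps_actC xa ps_act_one.
  congr (dg p _); apply/setP => i; rewrite !inE; case: (split i) => i'.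
    by apply: contraNneq (cP i') => ->.
  by rewrite jE eqxx.
apply: IHs => //.
  by move: jP; rewrite (leq_eqVlt j) (negPf js).
move=> i; case: (split i) => i'; last by rewrite /= ltnn.
apply: contra (cP i') => /andP[-> /leqW] //.
Qed.

Lemma cr_colour0 s a x :
  x \in cr G s a ->
  act (dg p [set i | colour (s := s) (fun _ : 'I_a => 0) i != 0]) x = 1.
Proof.
case: s x => [|b s] x /=; rewrite inE.
  move=> /eqP x1; rewrite (_ : dg p _ = (0 : 'M_(a, 0)) *m 0)%R; last first.
    by apply/matrixP => i j; rewrite mulmx0 !mxE !inE andbF.
  by rewrite ps_actC x1 ps_act_one.
move=> /and3P[_ _ /eqP xb].
rewrite (@dg_colour p s _ _ [pred l | l != 0]) => [|[|l]] //=.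
rewrite (_ : dg p _ =
    dg p [set i : 'I_(a + b) | if split i is inl _ then false else true]).
  by rewrite dg_rshift extmM ps_actC xb ps_act_one.
by congr (dg p _); apply/setP => i; rewrite !inE; case: (split i).
Qed.

Lemma cross_vanish_poly_deg_le n : cross_vanish G n -> poly_deg_le G n.
Proof.
move=> vG s a szs; apply/setP => x; rewrite !inE; apply/idP/eqP => [xcr|->]; last first.
  elim: s a {szs x} => [|b s IHs] a /=; first by rewrite inE ps_act_one.
  by rewrite inE IHs !ps_act_one !eqxx.
apply/set1gP; apply: detection_dg vG _ => U leUn.
pose col := colour (s := s) (fun _ : 'I_a => 0).
(* Pigeonhole: at most [n] coordinates cannot meet all the [n + 1] colours. *)
have [j js jU] : exists2 j, j <= size s & forall i, i \in U -> col i != j.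
  pose h i : 'I_(size s).+1 := inord (col i); pose D := [set h i | i in U].
  have [j jD] : exists j, j \notin D.
    apply/existsP; apply: contraTT (leq_imset_card h U).
    rewrite negb_exists => /forallP DT.
    rewrite -/D (_ : D = [set: _]) ?cardsT ?card_ord -?ltnNge ?szs ?ltnS //.
    by apply/setP => j; have := DT j; rewrite negbK inE => ->.
  exists j => [|i iU]; first by rewrite -ltnS.
  apply: contraNneq jD => ej; apply/imsetP; exists i => //.
  by rewrite /h ej inord_val.
have -> : dg p U = (dg p U *m dg p [set i | col i != j])%R.
  rewrite dgI; congr (dg p _); apply/setP => i; rewrite !inE.
  by case: (boolP (i \in U)) => // /jU ->.
rewrite ps_actC (_ : act (dg p [set i | _]) x = 1) ?ps_act_one ?group1 //.
by case: j js {jU} => [|j] js; [exact: cr_colour0 | exact: cr_colour].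
Qed.

End PolynomialDegree.

(** * Growth *)

Section Growth.

Variables (p : nat) (hp : prime p) (G : presheaf p).
Local Open Scope group_scope.
Local Notation act := (ps_act G).

Lemma card_growth t : #|G t| = (p ^ growth G t)%N.
Proof. by rewrite -cardsT -(card_pgroup (ps_pgroup G t)). Qed.

Lemma cross_vanish_growth n : cross_vanish G n -> growth_poly_bounded G.
Proof.
(* There are [(t + 1) ^ n] maps [sel f], and an element of [G t] is determined by its images in
   [G n]; for [t >= 1] one has [t + 1 <= 2 * t]. *)
move=> vG; exists n, (growth G n * 2 ^ n)%N, 1%N => t t_gt0.
pose h (x : G t) := [ffun f : {ffun 'I_n -> option 'I_t} => act (sel p f) x].
have h_inj : injective h.
  move=> x y /ffunP hxy; apply/eqP; rewrite eq_mulgV1 -in_set1.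
  apply: (detection (K := @botfam p G) vG (@subps_bot p G)) => f.
  have := hxy f; rewrite !ffunE ps_actM ps_actV => ->.
  by rewrite mulgV group1.
have := leq_card h h_inj; rewrite card_ffun card_ffun card_option !card_ord.
rewrite !card_growth -expnM leq_exp2l ?prime_gt1 // => /leq_trans -> //.
rewrite -mulnA -expnMn leq_mul2l; apply/orP; right.
have [->|n_gt0] := posnP n; first by rewrite !expn0.
by rewrite leq_exp2r // mul2n -addnn -addn1 leq_add2l.
Qed.

(** The coordinate embedding of [F_p^t] in [F_p^(t * m)], seen as having basis indexed by pairs,
    along the graph of [f]. *)
Definition graph_mx t m (f : {ffun 'I_t -> 'I_m}) : 'M['F_p]_(t, t * m) :=
  (\matrix_(i, j) (j == mxvec_index i (f i))%:R)%R.

Lemma graph_mxM t m (f g : {ffun 'I_t -> 'I_m}) :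
  (graph_mx f *m (graph_mx g)^T)%R = dg p [set i | f i == g i].
Proof.
apply/matrixP => i j; rewrite !mxE (bigD1 (mxvec_index i (f i))) //= !mxE eqxx mul1r.
rewrite big1 ?addr0 => [|l /negPf lf]; last by rewrite !mxE lf mul0r.
rewrite inE; congr ((nat_of_bool _)%:R)%R; apply/eqP/andP => [|[/eqP -> /eqP ->]] //.
by move/cast_ord_inj/enum_rank_inj => [-> ->]; rewrite !eqxx.
Qed.

(** The pullbacks [w f] of [z], for [f] supported on [S], are dual to the restrictions along the
    graphs: the pairing is [z] if the functions agree and [1] otherwise. So their products over
    distinct subsets of [F] are distinct. *)
Lemma growth_cross_card t (S : {set 'I_t}) (z : G t) m :
  cross S z -> z != 1 -> m.+1 ^ #|S| <= p * growth G (t * m.+1).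
Proof.
move=> [zS zU] z1; pose F := [set f in pffun_on (@ord0 m) (mem S) predT].
have cF : #|F| = (m.+1 ^ #|S|)%N by rewrite cardsE card_pffun_on card_ord.
pose w (f : {ffun 'I_t -> 'I_m.+1}) : G (t * m.+1)%N := act (graph_mx f)^T%R z.
have wE f g : f \in F -> g \in F -> act (graph_mx f) (w g) = if g == f then z else 1.
  rewrite !inE => /pffun_onP[/supportP f0 _] /pffun_onP[/supportP g0 _].
  rewrite /w -ps_actC graph_mxM; case: eqVneq => [->|gf].
    rewrite (_ : [set _ | _] = setT) ?dg_setT ?ps_act1 //.
    by apply/setP => i; rewrite !inE eqxx.
  apply: zU; apply: contra gf => /subsetP fg; apply/eqP/ffunP => i.
  have [/fg|iS] := boolP (i \in S); first by rewrite inE => /eqP.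
  by rewrite f0 ?g0.
pose psi (U : {set {ffun 'I_t -> 'I_m.+1}}) := \prod_(f in U) w f.
have psiE f (U : {set {ffun 'I_t -> 'I_m.+1}}) : f \in F -> U \subset F ->
    act (graph_mx f) (psi U) = if f \in U then z else 1.
  move=> fF /subsetP UF.
  rewrite /psi (big_morph _ (ps_actM (graph_mx f)) (ps_act_one _ _)).
  rewrite (eq_bigr (fun g => if g == f then z else 1)) => [|g /UF gF]; last exact: wE.
  rewrite -big_mkcondr; case: (boolP (f \in U)) => fU.
    by rewrite (big_pred1 f) // => g /=; case: eqP => [->|]; rewrite ?fU ?andbF.
  by rewrite big_pred0 // => g /=; case: eqP => [->|]; rewrite ?(negPf fU) ?andbF.
have psi_inj : {in powerset F &, injective psi}.
  move=> U V; rewrite !inE => UF VF eUV; apply/setP => f.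
  have [fF|fF] := boolP (f \in F); last first.
    by apply/idP/idP => [/(subsetP UF)|/(subsetP VF)]; rewrite (negPf fF).
  have := psiE f U fF UF; rewrite eUV psiE //.
  by case: (f \in U); case: (f \in V) => // /eqP; rewrite ?(negPf z1) // eq_sym (negPf z1).
have := max_card [in psi @: powerset F].
rewrite card_in_imset // card_powerset cF card_growth => le2p.
(* The bound [2 ^ #|F| <= p ^ growth] is turned into one on exponents by [p <= 2 ^ p]. *)
rewrite -(@leq_exp2l 2) // (leq_trans le2p) // expnM.
have [->|g_gt0] := posnP (growth G (t * m.+1)); first by rewrite !expn0.
by rewrite leq_exp2r // ltnW // ltn_expl.
Qed.

Lemma growth_cross_vanish : growth_poly_bounded G -> exists n, cross_vanish G n.
Proof.
move=> [d [C [T gG]]]; exists d => t S z ltdS cz; apply/eqP; apply: contraTT isT => z1.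
have t_gt0 : 0 < t.
  by rewrite -[t]card_ord; apply: leq_trans (max_card [in S]); apply: leq_trans ltdS.
(* The summand [T] puts [t * m.+1] in the range of the bound; the other one makes [m.+1 ^ d.+1]
   exceed [p * C * (t * m.+1) ^ d]. *)
pose m := (T + p * C * t ^ d)%N.
have le_mN : T <= t * m.+1.
  rewrite (leq_trans (leq_addr (p * C * t ^ d) T)) //.
  by rewrite (leq_trans (leqnSn _)) // leq_pmull.
have := growth_cross_card m cz z1.
rewrite leqNgt => /negP[]; apply: (@leq_ltn_trans (p * (C * (t * m.+1) ^ d))).
  by rewrite leq_mul2l gG ?orbT.
apply: (@leq_trans (m.+1 ^ d.+1)); last by rewrite leq_pexp2l.
by rewrite expnMn expnS !mulnA ltn_pmul2r ?expn_gt0 // ltnS leq_addl.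
Qed.

End Growth.

(** * Maximal chains *)

Lemma maximal_nat (X : Type) (P : X -> Prop) (mu : X -> nat) b x0 :
  P x0 -> (forall x, P x -> mu x <= b) ->
  exists2 x, P x & forall y, P y -> mu y <= mu x.
Proof.
move=> Px0 Pb; have [k] := ubnP (b - mu x0); elim: k x0 Px0 => // k IHk x0 Px0 lek.
have [[y [Py lty]]|nex] := classic (exists y, P y /\ mu x0 < mu y); last first.
  by exists x0 => // y Py; rewrite leqNgt; apply/negP => lty; apply: nex; exists y.
apply: (IHk y) => //; move: lek; rewrite ltnS; apply: leq_trans.
by rewrite ltn_sub2l // (leq_trans lty) // Pb.
Qed.

Section MaximalChains.

Variables (X : Type) (ok : X -> Prop) (le R eqv : X -> X -> Prop) (mu : X -> nat).
Variable bot : X.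

Hypothesis eqv_sym : forall x y, eqv x y -> eqv y x.
Hypothesis le_refl : forall x, le x x.
Hypothesis R_le : forall x y, R x y -> le x y.
Hypothesis le_trans : forall x y z, le x y -> le y z -> le x z.
Hypothesis mu_le : forall x y, ok x -> ok y -> le x y -> mu x <= mu y.
Hypothesis mu_eqv :
  forall x y, ok x -> ok y -> le x y -> mu y <= mu x -> eqv x y.
Hypothesis ok_bot : ok bot.
Hypothesis R_bot : forall x, ok x -> le bot x -> R bot x.

(** Induction on [mu H]: below [H] one picks an element of largest measure among those not
    equivalent to [H]. Anything between the two is then equivalent to one of them. *)
Lemma chain_exists H : ok H -> le bot H ->
  exists (N : nat) (L : nat -> X),
  [/\ L 0 = H, eqv (L N) bot, forall j, j <= N -> ok (L j) &
      forall j, j < N ->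
        [/\ R (L j.+1) (L j), ~ eqv (L j.+1) (L j) &
            forall M, ok M -> le (L j.+1) M -> R M (L j) ->
              eqv M (L j.+1) \/ eqv M (L j)]].
Proof.
have [k] := ubnP (mu H); elim: k H => // k IHk H leHk okH botH.
have [eH|neH] := classic (eqv bot H).
  by exists 0, (fun _ => H); split=> //; apply: eqv_sym.
have [M [okM botM RMH nMH] maxM] : exists2 M,
    [/\ ok M, le bot M, R M H & ~ eqv M H] &
    forall M', [/\ ok M', le bot M', R M' H & ~ eqv M' H] -> mu M' <= mu M.
  apply: (@maximal_nat _ _ mu (mu H) bot) => [|x [okx _ xH _]].
    by split=> //; apply: R_bot.
  by apply: mu_le => //; apply: R_le.
have ltMH : mu M < mu H.
  by rewrite ltnNge; apply/negP => leHM; apply: nMH; apply: mu_eqv => //; apply: R_le.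
have [N [L [L0 LN okL simL]]] := IHk M (leq_trans ltMH leHk) okM botM.
exists N.+1, (fun j => if j is j'.+1 then L j' else H); split=> //.
  by case=> [|j] // /okL.
case=> [|j] ltjN; last exact: simL.
rewrite L0; split=> // M' okM' leMM' RM'H.
have [e|ne] := classic (eqv M' H); [by right | left; apply: eqv_sym].
by apply: mu_eqv => //; apply: maxM; split=> //; apply: le_trans leMM'.
Qed.

End MaximalChains.

Section FiniteLength.

Variables (p : nat) (G : presheaf p).
Local Open Scope group_scope.

Local Notation family := (forall n, {group G n}).

Lemma not_eqfam (H K : family) : ~ eqfam H K -> exists n, H n != K n.
Proof.
move=> neHK; apply: NNPP => nex; apply: neHK => n; apply/eqP.
by apply/negPn/negP => nHK; apply: nex; exists n.
Qed.

(** The order of the value at [F_p^n] serves as the measure. The relation [R] is left open so as to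
    cover both inclusion and normal inclusion. *)
Lemma chain_subps n (H K : family) (R : family -> family -> Prop) :
  cross_vanish G n -> subps H -> subps K -> (forall t, K t \subset H t) ->
  (forall M M', R M M' -> forall t, M t \subset M' t) ->
  (forall M, subps M -> (forall t, K t \subset M t) -> R K M) ->
  exists (N : nat) (L : nat -> family),
  [/\ eqfam (L 0) H, eqfam (L N) K,
      forall j, j <= N -> subps (L j) &
      forall j, j < N ->
        [/\ R (L j.+1) (L j), exists n, L j.+1 n != L j n &
            forall M, subps M -> (forall t, L j.+1 t \subset M t) ->
              R M (L j) -> eqfam M (L j.+1) \/ eqfam M (L j)]].
Proof.
move=> vG sH sK sKH R_le R_K.
pose le (M M' : family) := forall t, M t \subset M' t.
have [] := @chain_exists _ (@subps p G) le R (@eqfam p G) (fun M => #|M n|)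
  K _ _ R_le _ _ _ sK R_K H sH sKH.
- by move=> M M' e t; rewrite e.
- by move=> M t.
- by move=> M1 M2 M3 s12 s23 t; apply: subset_trans (s12 t) (s23 t).
- by move=> M M' _ _ sMM'; apply: subset_leq_card.
- by move=> M M' sM sM' sMM'; apply: (detection_eq vG).
move=> N [L [L0 LN sL simL]].
exists N, L; split=> // [|j ltjN]; first by rewrite L0.
by have [RL nL simLj] := simL j ltjN; split=> //; apply: not_eqfam.
Qed.

Lemma cross_vanish_finite_section n (H K : family) :
  cross_vanish G n -> subps H -> subps K -> (forall t, K t \subset H t) ->
  finite_section H K.
Proof.
move=> vG sH sK sKH.
by apply: (chain_subps (R := fun M M' => forall t, M t \subset M' t) vG).
Qed.

Lemma cross_vanish_comp_series n : cross_vanish G n -> comp_series G.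
Proof.
move=> vG.
apply: (chain_subps (R := fun M M' => forall t, M t <| M' t) vG).
- exact: subps_top.
- exact: subps_bot.
- by move=> t; apply: sub1G.
- by move=> M M' nMM' t; apply: normal_sub.
- by move=> M _ _ t; apply: normal1.
Qed.

End FiniteLength.

(** * Simple sections *)

Section FiniteDifferences.

Variables (E V : zmodType).
Local Open Scope ring_scope.

Fixpoint dif (gs : seq E) (phi : E -> V) (a : E) : V :=
  if gs is g :: gs' then dif gs' phi (a + g) - dif gs' phi a else phi a.

Lemma dif_ext gs phi psi a : phi =1 psi -> dif gs phi a = dif gs psi a.
Proof. by move=> e; elim: gs a => [|g gs IHgs] a /=; rewrite ?IHgs. Qed.

Lemma difD gs phi psi a :
  dif gs (fun b => phi b + psi b) a = dif gs phi a + dif gs psi a.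
Proof. by elim: gs a => //= g gs IHgs a; rewrite !IHgs opprD addrACA. Qed.

Lemma difN gs phi a : dif gs (fun b => - phi b) a = - dif gs phi a.
Proof. by elim: gs a => //= g gs IHgs a; rewrite !IHgs opprD. Qed.

Lemma dif0 gs a : dif gs (fun _ => 0) a = 0.
Proof. by elim: gs a => //= g gs IHgs a; rewrite !IHgs subrr. Qed.

Lemma dif_shift gs phi a b : dif gs (fun c => phi (c + b)) a = dif gs phi (a + b).
Proof. by elim: gs a => //= g gs IHgs a; rewrite !IHgs addrAC. Qed.

Lemma dif_cat gs hs phi a : dif (gs ++ hs) phi a = dif gs (dif hs phi) a.
Proof. by elim: gs a => //= g gs IHgs a; rewrite !IHgs. Qed.

Lemma difC gs hs phi a : dif gs (dif hs phi) a = dif hs (dif gs phi) a.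
Proof.
elim: gs a => [|g gs IHgs] a //=.
by rewrite !IHgs -dif_shift -difN -difD.
Qed.

Lemma dif_perm gs hs phi a : perm_eq gs hs -> dif gs phi a = dif hs phi a.
Proof.
move=> ghs; pose P s := dif gs phi a = dif s phi a.
apply: (@catCA_perm_ind _ P _ _ _ ghs) => // s1 s2 s3; rewrite /P => ->.
by rewrite !catA (dif_cat (s1 ++ s2)) (dif_cat (s2 ++ s1)) !dif_cat difC.
Qed.

End FiniteDifferences.

Lemma dif_comp (E E' V : zmodType) (h : {additive E -> E'}) gs (phi : E' -> V) a :
  dif [seq h g | g <- gs] phi (h a) = dif gs (fun b => phi (h b)) a.
Proof. by elim: gs a => //= g gs IHgs a; rewrite -raddfD !IHgs. Qed.

(** * Vanishing of long iterated differences on an elementary abelian group *)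

Section Nilpotence.

Variables (p : nat) (hp : prime p) (E : finZmodType) (V : lmodType 'F_p).
Local Open Scope ring_scope.

Let ev (phi : E -> V) g n (q : {poly 'F_p}) a :=
  \sum_(i < n) q`_i *: phi (a + g *+ i).

(* F_p[X] acts on functions, X being the translation by g; the difference
   operator is then X - 1, and (X - 1)^p = X^p - 1 acts as 0. *)
Lemma dif_nseq (phi : E -> V) g a : g *+ p = 0 -> dif (nseq p g) phi a = 0.
Proof.
move=> gp0.
have evW n n' (q : {poly 'F_p}) b : (size q <= n)%N -> (n <= n')%N ->
    ev phi g n q b = ev phi g n' q b.
  move=> qn nn'; rewrite /ev (big_ord_widen n' (fun i => q`_i *: phi (b + g *+ i))) //.
  rewrite [RHS](bigID (fun i : 'I_n' => (i < n)%N)) /= [X in _ + X]big1 ?addr0 // => i.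
  by rewrite -leqNgt => ni; rewrite nth_default ?scale0r ?(leq_trans qn).
have evX n q b : ev phi g n.+1 ('X * q) b = ev phi g n q (b + g).
  rewrite /ev big_ord_recl coefXM /= scale0r add0r; apply: eq_bigr => i _.
  by rewrite coefXM /= mulrS addrA.
have evB n q r b : ev phi g n (q - r) b = ev phi g n q b - ev phi g n r b.
  by rewrite /ev -sumrB; apply: eq_bigr => i _; rewrite coefB scalerBl.
have ev_dif k b : dif (nseq k g) phi b = ev phi g k.+1 (('X - 1) ^+ k) b.
  elim: k b => [|k IHk] b /=.
    by rewrite /ev big_ord_recl big_ord0 coef1 scale1r mulr0n !addr0.
  rewrite !IHk exprS mulrBl mul1r evB evX; congr (_ - _); apply: evW => //.
  have -> : 'X - 1 = 'X - 1%:P :> {poly 'F_p} by [].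
  by rewrite (size_exp_XsubC k 1).
have pcharp : p \in [pchar {poly 'F_p}] by rewrite pchar_poly pchar_Fp.
rewrite ev_dif -(pFrobenius_autE pcharp) pFrobenius_autB_comm; last exact: mulrC.
rewrite !pFrobenius_autE expr1n evB /ev big_ord_recr /= coefXn eqxx scale1r gp0 addr0.
rewrite big1 => [|i _]; last by rewrite coefXn ltn_eqF ?scale0r.
rewrite add0r big_ord_recl coef1 scale1r mulr0n addr0 big1 ?addr0 ?subrr // => i _.
by rewrite coef1 scale0r.
Qed.

Lemma sum_count_mem (s : seq E) : (\sum_x count_mem x s)%N = size s.
Proof.
elim: s => [|y s IHs] /=; first by rewrite big1.
rewrite big_split /= IHs (bigD1 y) //= eqxx big1 // => x.
by rewrite eq_sym => /negPf ->.
Qed.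

(** By pigeonhole some increment occurs at least [p] times; moved to the front, its [p] copies
    already give zero. *)
Lemma dif_nilpotent gs (phi : E -> V) a :
  (forall g : E, g *+ p = 0) -> (#|E| * p < size gs)%N -> dif gs phi a = 0.
Proof.
move=> pE lt_gs.
have [g leg] : exists g, (p <= count_mem g gs)%N.
  apply/existsP; apply: contraLR lt_gs; rewrite negb_exists => /forallP ltp.
  rewrite -leqNgt -sum_count_mem -sum_nat_const; apply: leq_sum => x _.
  by rewrite leqNgt; apply: contra (ltp x) => /ltnW.
rewrite -(@dif_perm _ _ (nseq p g ++ (nseq (count_mem g gs - p) g
          ++ [seq x <- gs | predC (pred1 g) x]))) ?dif_cat ?dif_nseq //.
rewrite catA -nseqD subnKC // -size_filter.
by rewrite -(all_pred1P _ _ (filter_all _ _)) perm_filterC.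
Qed.

End Nilpotence.

Section SimpleSections.

Variables (p : nat) (hp : prime p).
Local Open Scope group_scope.

(** Coordinates on the elementary abelian section [H / K], as a function on the whole ambient group
    that is meaningful only on [H]. This avoids quotient types. *)
Lemma abelem_coords (gT : finGroupType) (H K : {group gT}) :
  p.-group H -> K \subset H -> 'Phi(H) \subset K ->
  exists d (rho : gT -> 'rV['F_p]_d),
    {in H &, forall x y, rho (x * y) = (rho x + rho y)%R} /\
    {in H, forall x, (rho x == 0%R) = (x \in K)}.
Proof.
move=> pH sKH sPK.
have nKH : K <| H.
  apply: sub_der1_normal => //; apply: subset_trans sPK.
  by rewrite (Phi_joing pH) joing_subl.
have abHK : p.-abelem (H / K).
  rewrite -trivg_Phi ?quotient_pgroup // -(quotient_Phi pH) ?normal_norm //.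
  by rewrite -subG1 quotient_sub1 // (subset_trans (Phi_sub _)) ?normal_norm.
(* The library coordinates require a nontrivial group; the trivial quotient gets dimension [0]. *)
have [HK1|ntHK] := eqVneq (H / K) 1.
  exists 0, (fun _ => 0%R); split=> [x y _ _|x xH]; first by rewrite addr0.
  rewrite eqxx; symmetry; have: H \subset K by rewrite -quotient_sub1 ?normal_norm // HK1.
  by move/subsetP; apply.
have mem_HK x : x \in H -> coset K x \in H / K by move=> xH; rewrite mem_quotient.
have nK x : x \in H -> x \in 'N(K) by move/(subsetP (normal_norm nKH)).
exists _, (fun x => abelem_rV abHK ntHK (coset K x)); split=> [x y xH yH|x xH].
  by rewrite morphM ?nK // abelem_rV_M ?mem_HK.
rewrite -(abelem_rV_1 abHK ntHK).
rewrite (inj_in_eq (@abelem_rV_inj _ _ _ abHK ntHK)) ?mem_HK ?group1 //.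
by apply/eqP/idP => [/coset_idr->|/coset_id] //; apply: nK.
Qed.

Variable G : presheaf p.
Local Notation act := (ps_act G).
Local Notation family := (forall n, {group G n}).

Section DegreeFiltration.

Variables (H : family) (m d : nat) (rho : G m -> 'rV['F_p]_d).
Hypothesis sH : subps H.
Hypothesis rhoM : {in H m &, forall x y, rho (x * y) = (rho x + rho y)%R}.

Definition coord t (x : G t) (A : 'M['F_p]_(m, t)) : 'rV['F_p]_d := rho (act A x).

(** The elements whose coordinate function has degree less than [k]. Tuples of fixed length over a
    finite type make the condition boolean. *)
Definition deg_lt_set k t : {set G t} :=
  [set x in H t | [forall gs : k.-tuple 'M['F_p]_(m, t), forall a,
                    dif gs (coord x) a == 0%R]].

Lemma deg_ltP k t (x : G t) :
  reflect (x \in H t /\ forall gs, size gs = k -> forall a, dif gs (coord x) a = 0%R)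
          (x \in deg_lt_set k t).
Proof.
rewrite inE; apply: (iffP andP) => [[xH /forallP P]|[xH P]]; split=> //.
  by move=> gs /eqP szgs a; have /forallP/(_ a)/eqP := P (Tuple szgs).
by apply/forallP => gs; apply/forallP => a; rewrite P ?size_tuple.
Qed.

Lemma coordM t (x y : G t) A : x \in H t -> y \in H t ->
  coord (x * y) A = (coord x A + coord y A)%R.
Proof. by move=> xH yH; rewrite /coord ps_actM rhoM ?sH. Qed.

Lemma coord1 t A : coord (1 : G t) A = 0%R.
Proof. by apply: (addrI (coord 1 A)); rewrite -coordM ?group1 // mulg1 addr0. Qed.

Lemma deg_lt_group_set k t : group_set (deg_lt_set k t).
Proof.
apply/group_setP; split=> [|x y].
  apply/deg_ltP; split=> // gs _ a.
  by rewrite (dif_ext _ _ (coord1 (t := t))) dif0.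
move=> /deg_ltP[xH x0] /deg_ltP[yH y0]; apply/deg_ltP; split=> [|gs szgs a].
  exact: groupM.
by rewrite (dif_ext _ _ (fun A => coordM A xH yH)) difD x0 ?y0 ?addr0.
Qed.
Definition deg_lt k : family := fun t => Group (deg_lt_group_set k t).

(** Restriction along [A] precomposes the coordinate function with the linear map of right
    multiplication by [A], which carries differences to differences. *)
Lemma subps_deg_lt k : subps (deg_lt k).
Proof.
move=> t t' A x /deg_ltP[xH x0]; apply/deg_ltP; split=> [|gs szgs a]; first exact: sH.
have e B : coord (act A x) B = coord x (mulmxr A B) by rewrite /coord -ps_actC.
by rewrite (dif_ext _ _ e) -dif_comp x0 // size_map.
Qed.

(** The coordinates take values in an abelian group, so conjugation by elements of [H] does not
    change them. *)
Lemma deg_lt_normal k t : deg_lt k t <| H t.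
Proof.
apply/andP; split; first by apply/subsetP => x /deg_ltP[].
apply/subsetP => y yH; rewrite inE; apply/subsetP => _ /imsetP[x /deg_ltP[xH x0] ->].
apply/deg_ltP; split=> [|gs szgs a]; first by rewrite groupJ.
rewrite (@dif_ext _ _ _ _ (coord x)) ?x0 // => A.
rewrite conjgE !coordM ?groupM ?groupV // addrCA -coordM ?groupV //.
by rewrite mulVg coord1 addr0.
Qed.

End DegreeFiltration.

(** In the expanded difference, every term that omits an increment factors through a projection
    missing a line of [S], so it vanishes. Only the full sum survives. *)
Lemma dif_cross t (S T : {set 'I_t}) (z : G t) m (A : 'M['F_p]_(m, t))
    (V : zmodType) (rho : G m -> V) s :
  rho 1 = 0%R -> cross S z -> uniq s -> {subset s <= S} -> {in s, forall i, i \notin T} ->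
  dif [seq A *m dg p [set i] | i <- s]%R (fun B => rho (act B z)) (A *m dg p T)%R
  = rho (act (A *m dg p (T :|: [set i in s])) z)%R.
Proof.
move=> rho1 cz; elim: s T => [|i s IHs] T /=.
  by move=> _ _ _; congr (rho (act (_ *m dg p _)%R _)); apply/setP => j; rewrite !inE orbF.
move=> /andP[i_s us] sS sT.
have sS' : {subset s <= S} by move=> j js; rewrite sS // inE js orbT.
rewrite -mulmxDr -dg_setU1 ?sT ?mem_head // !IHs //.
- have [_ zU] := cz; rewrite [in X in (_ - X)%R]ps_actC zU ?ps_act_one ?rho1 ?subr0.
    by congr (rho (act (_ *m dg p _)%R _)); apply/setP => j; rewrite !inE orbCA orbA.
  by apply/subsetPn; exists i; rewrite ?sS ?mem_head // !inE negb_or i_s sT ?mem_head.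
- by move=> j js; rewrite sT // inE js orbT.
- move=> j js; rewrite !inE negb_or sT ?inE ?js ?orbT // andbT.
  by apply: contraNneq i_s => <-.
Qed.

Lemma simple_section (H K : family) :
  subps H -> subps K -> (forall n, K n \subset H n) ->
  (forall n, 'Phi(H n) \subset K n) ->
  (forall M : family, subps M -> (forall n, K n \subset M n) ->
     (forall n, M n <| H n) -> eqfam M K \/ eqfam M H) ->
  exists k, forall t (S : {set 'I_t}) z,
    k <= #|S| -> cross S z -> z \in H t -> z \in K t.
Proof.
move=> sH sK sKH sPK simp.
have [eKH|/not_eqfam[m neKH]] := classic (eqfam K H).
  by exists 0 => t S z _ _; rewrite eKH.
have pH n : p.-group (H n) by apply: pgroupS (subsetT _) (ps_pgroup G n).
have [d [rho [rhoM rhoK]]] := abelem_coords (pH m) (sKH m) (sPK m).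
have rho1 : rho 1 = 0%R by apply/eqP; rewrite rhoK group1.
pose M k := deg_lt sH rhoM k.
have sKM k n : K n \subset M k n.
  apply/subsetP => x xK; apply/deg_ltP; split=> [|gs _ a]; first exact: (subsetP (sKH n)).
  rewrite (@dif_ext _ _ _ _ (fun _ => 0%R)) ?dif0 // => A; apply/eqP.
  by rewrite rhoK ?sK // sH ?(subsetP (sKH n)).
have Mdich k : eqfam (M k) K \/ eqfam (M k) H.
  by apply: simp => //; [exact: subps_deg_lt | move=> n; exact: deg_lt_normal].
have M0 : eqfam (M 0) K.
  have [//|e] := Mdich 0; case/negP: neKH; rewrite -val_eqE eqEsubset sKH /= -(e m).
  apply/subsetP => x /deg_ltP[xH x0]; rewrite -rhoK //; apply/eqP.
  by have := x0 [::] erefl 1%:M%R; rewrite /= /coord ps_act1.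
(* One more than the number of increments allowed by the pigeonhole argument on square matrices of
   size [m]. *)
pose k := (#|{:'M['F_p]_(m, m)}| * p).+1; exists k => t S z leS cz zH.
have Mk : eqfam (M k) H.
  have [e|//] := Mdich k; case/negP: neKH; rewrite -val_eqE eqEsubset sKH /= -(e m).
  apply/subsetP => x xH; apply/deg_ltP; split=> // gs szgs a.
  apply: (dif_nilpotent hp); rewrite ?szgs // => g.
  by rewrite -scaler_nat pchar_Fp_0 // scale0r.
rewrite -(M0 t); apply/deg_ltP; split=> // gs /size0nil -> A /=.
(* With the increments taken along [k] lines of [S] and the base point along the others, the
   vanishing [k]-fold difference equals the coordinate of [z] at [A]. So [z] has degree less than
   [0], that is, lies in [K]. *)
pose s := take k (enum S).
have sS : {subset s <= S} by move=> i /mem_take; rewrite mem_enum.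
have := zH; rewrite -(Mk t) => /deg_ltP[_ /(_ [seq A *m dg p [set i] | i <- s]%R)].
rewrite size_map size_takel -?cardE // => /(_ erefl (A *m dg p (S :\: [set i in s]))%R).
rewrite (dif_cross _ rho1 cz) ?take_uniq ?enum_uniq //; last first.
  by move=> i is_; rewrite !inE is_.
rewrite (_ : _ :|: _ = S); last first.
  apply/setP => i; rewrite !inE.
  by case: (boolP (i \in s)) => [/sS ->|]; rewrite ?orbT ?orbF.
by rewrite ps_actC; case: cz => ->.
Qed.

End SimpleSections.

(** * The Frattini series *)

Section FrattiniSeries.

Variables (p : nat) (hp : prime p) (G : presheaf p).
Local Open Scope group_scope.
Local Notation act := (ps_act G).
Local Notation family := (forall n, {group G n}).

Definition ps_morphism m n (A : 'M['F_p]_(m, n)) : {morphism [set: G n] >-> G m} :=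
  @Morphism _ _ [set: G n] (act A) (fun x y _ _ => ps_actM A x y).

Lemma subps_morphim (H : family) m n (A : 'M['F_p]_(m, n)) :
  subps H -> ps_morphism A @* H n \subset H m.
Proof. by move=> sH; apply/subsetP => _ /morphimP[x _ xH ->]; apply: sH. Qed.

(** For [p]-groups the Frattini subgroup commutes with homomorphic images and is monotone under
    inclusion. *)
Lemma subps_Phi (H : family) : subps H -> subps (fun n => 'Phi(H n)%G).
Proof.
move=> sH m n A x xPhi.
have pH k : p.-group (H k) by apply: pgroupS (subsetT _) (ps_pgroup G k).
apply: (subsetP (PhiS (pH m) (subps_morphim A sH))).
rewrite -(morphim_Phi _ (pH n)) ?subsetT //.
by apply/morphimP; exists x; rewrite ?in_setT.
Qed.

Lemma subps_joing (H K : family) :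
  subps H -> subps K -> subps (fun n => (H n <*> K n)%G).
Proof.
move=> sH sK m n A x xHK.
have : act A x \in ps_morphism A @* (H n <*> K n).
  by apply/morphimP; exists x; rewrite ?in_setT.
rewrite morphimY ?subsetT //; apply: subsetP; rewrite join_subG.
by rewrite !(subset_trans (subps_morphim A _)) ?joing_subl ?joing_subr.
Qed.

Lemma subps_Phin k : subps (Phin G k).
Proof. by elim: k => [|k IHk]; [exact: subps_top | exact: subps_Phi]. Qed.

Lemma pgroup_Phin k n : p.-group (Phin G k n).
Proof. exact: pgroupS (subsetT _) (ps_pgroup G n). Qed.

Lemma Phin_subS k n : Phin G k.+1 n \subset Phin G k n.
Proof. exact: Phi_sub. Qed.

Lemma Phin_sub k l n : k <= l -> Phin G l n \subset Phin G k n.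
Proof.
by move/subnK <-; elim: (l - k)%N => // j IHj; apply: subset_trans (Phin_subS _ _) IHj.
Qed.

Lemma Phin_stable k n : Phin G k n \subset Phin G k.+1 n -> Phin G k n :=: 1.
Proof.
move=> sPhi; apply/eqP; apply: contraTT sPhi => /Phi_proper.
by rewrite properE => /andP[].
Qed.

(** The order drops by at least one at each step until the trivial group is reached. *)
Lemma Phin_eq1 n : exists k, Phin G k n :=: 1.
Proof.
have H k : Phin G k n :=: 1 \/ #|Phin G k n| + k <= #|G n|.
  elim: k => [|k [IHk|IHk]]; first by right; rewrite addn0 cardsT.
    by left; apply/trivgP; rewrite -IHk Phin_subS.
  have [e|ne] := eqsVneq (Phin G k n) 1.
    by left; apply/trivgP; rewrite -e Phin_subS.
  right; apply: leq_trans IHk; rewrite addnS -addSn leq_add2r.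
  exact: proper_card (Phi_proper ne).
exists #|G n|; case: (H #|G n|) => //.
by rewrite -{3}[#|G n|]add0n leq_add2r leqNgt cardG_gt0.
Qed.

(** A form of the vanishing of the cross effects of [H / K] in large rank, stated with elements of
    [G] so that it composes along chains. *)
Definition cross_into (H K : family) : Prop :=
  exists k, forall t (S : {set 'I_t}) z,
    k <= #|S| -> cross S z -> z \in H t -> z \in K t.

Lemma cross_into_chain N (L : nat -> family) :
  (forall j, j < N -> cross_into (L j) (L j.+1)) -> cross_into (L 0) (L N).
Proof.
elim: N => [|N IHN] LN; first by exists 0.
have [j ltjN|k1 c1] := IHN; first by apply: LN; apply: leqW.
have [k2 c2] := LN N (ltnSn N); exists (maxn k1 k2) => t S z.
by rewrite geq_max => /andP[le1 le2] cz /(c1 _ _ _ le1 cz); apply: c2 cz.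
Qed.

Lemma cross_into_vanish : cross_into (@topfam p G) (@botfam p G) ->
  exists n, cross_vanish G n.
Proof.
move=> [k ck]; exists k => t S z ltkS cz; apply/set1gP.
by apply: (ck t S) => //; [exact: ltnW | rewrite inE].
Qed.

Lemma cross_into_eqfam (H H' K K' : family) :
  eqfam H H' -> eqfam K K' -> cross_into H K -> cross_into H' K'.
Proof. by move=> eH eK [k ck]; exists k => t S z; rewrite -eH -eK; apply: ck. Qed.

Lemma comp_series_cross_vanish : comp_series G -> exists n, cross_vanish G n.
Proof.
move=> [N [L [L0 LN sL simL]]]; apply: cross_into_vanish.
apply: (cross_into_eqfam L0 LN); apply: cross_into_chain => j ltjN.
have [nL [n neL] simLj] := simL j ltjN.
have sLj := sL j (ltnW ltjN); have sLj1 := sL j.+1 ltjN.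
apply: (simple_section hp) => // [k|]; first exact: normal_sub.
(* Simplicity forces [Phi(L j)] into [L j.+1]: otherwise the two together would give [L j], and
   Frattini elements, being nongenerators, could be dropped. *)
pose M : family := fun k => (L j.+1 k <*> 'Phi(L j k))%G.
have [k|k|eM|eM] := simLj M (subps_joing sLj1 (subps_Phi sLj)).
- exact: joing_subl.
- exact: normalY (nL k) (Phi_normal _).
- by move=> k; rewrite -(eM k) joing_subr.
case/negP: neL; rewrite -val_eqE; apply/eqP => /=.
by rewrite -[LHS]genGid; apply: Phi_nongen; rewrite joingC; apply: eM.
Qed.

Lemma finite_section_cross_into (H K : family) :
  (forall n, 'Phi(H n) \subset K n) -> finite_section H K -> cross_into H K.
Proof.
move=> sPK [N [L [L0 LN sL simL]]].
have sLH j n : j <= N -> L j n \subset H n.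
  elim: j => [|j IHj] ltjN; first by rewrite L0.
  by have [sLj _ _] := simL j ltjN; apply: subset_trans (sLj n) (IHj (ltnW ltjN)).
have sKL j n : j <= N -> K n \subset L j n.
  (* Downward induction from [N]; once [i] reaches [N], truncated subtraction makes both indices
     [0]. *)
  move=> /subKn <-; elim: (N - j)%N => [|i IHi]; first by rewrite subn0 LN.
  have [leNi|ltiN] := leqP N i.
    by move: IHi; rewrite (eqP leNi) (eqP (leqW leNi)).
  have ltN : N - i.+1 < N by rewrite ltn_subrL /= (leq_ltn_trans _ ltiN).
  have [sLj _ _] := simL _ ltN; apply: subset_trans IHi _.
  by have := sLj n; rewrite subnSK.
apply: (cross_into_eqfam L0 LN); apply: cross_into_chain => j ltjN.
have [sLj _ simLj] := simL j ltjN.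
apply: (simple_section hp) => // [||n|M sM sLM nML]; try exact: sL.
- exact: sL (ltnW ltjN).
- apply: subset_trans (PhiS _ (sLH j n (ltnW ltjN))) (subset_trans (sPK n) (sKL _ n ltjN)).
  exact: pgroupS (subsetT _) (ps_pgroup G n).
- by apply: simLj => // n; apply: normal_sub.
Qed.

Lemma cond3_cross_vanish : cond3 G -> exists n, cross_vanish G n.
Proof.
move=> [[N PhiN] finPhi]; apply: cross_into_vanish.
apply: (cross_into_eqfam (H := Phin G 0)) PhiN _ => //.
by apply: cross_into_chain => j _; apply: finite_section_cross_into.
Qed.

Lemma cross_vanish_Phin n : cross_vanish G n -> exists N, eqfam (Phin G N) (@botfam p G).
Proof.
move=> vG; have [N PhiN] := Phin_eq1 n; exists N => t; symmetry.
apply: (detection_eq vG) => //; [exact: subps_Phin | exact: subps_bot | |].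
  by move=> k; apply: sub1G.
by rewrite PhiN.
Qed.

Lemma cross_vanish_cond3 n : cross_vanish G n -> cond3 G.
Proof.
move=> vG; split=> [|i]; first exact: cross_vanish_Phin vG.
apply: (cross_vanish_finite_section vG); try exact: subps_Phin.
by move=> t; apply: Phin_subS.
Qed.

Lemma finite_section_comp_series :
  (forall n, abelian [set: G n]) ->
  finite_section (@topfam p G) (@botfam p G) -> comp_series G.
Proof.
move=> abG [N [L [L0 LN sL simL]]]; exists N, L; split=> // j ltjN.
have [sLj neL simLj] := simL j ltjN; split=> // [n|M sM sLM nML].
  by rewrite -sub_abelian_normal ?sLj //; apply: abelianS (subsetT _) (abG n).
by apply: simLj => // n; apply: normal_sub.
Qed.

End FrattiniSeries.

(** * The graded functor of the Frattini series *)

Definition decb (P : Prop) : bool := excluded_middle_informative P.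

Lemma decbP (P : Prop) : reflect P (decb P).
Proof. by rewrite /decb; case: excluded_middle_informative => h; constructor. Qed.

Section GradedFunctor.

Variables (p : nat) (hp : prime p) (G : presheaf p).
Local Open Scope group_scope.
Local Notation act := (ps_act G).
Local Notation family := (forall n, {group G n}).
Local Notation gpred := (forall n, (nat -> G n) -> Prop).

(** Congruences modulo [Phin G k.+1] become identities between vectors. *)
Lemma Phin_coords k n : exists d (rho : G n -> 'rV['F_p]_d),
  [/\ {in Phin G k n &, forall x y, rho (x * y) = (rho x + rho y)%R},
      {in Phin G k n, forall x, rho x^-1 = (- rho x)%R} &
      {in Phin G k n, forall x, (rho x == 0%R) = (x \in Phin G k.+1 n)}].
Proof.
have [d [rho [rhoM rhoK]]] :=
  abelem_coords (pgroup_Phin G k n) (Phin_subS G k n) (subxx _).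
exists d, rho; split=> // x xP; apply: (addrI (rho x)).
by rewrite -rhoM ?groupV // mulgV subrr; apply/eqP; rewrite rhoK ?group1.
Qed.

Lemma gel_Phin n (x : nat -> G n) k : gel x -> x k \in Phin G k n.
Proof. by case=> + _; apply. Qed.

Lemma gel1 n : gel (fun _ => 1 : G n).
Proof. by split=> [k|]; [exact: group1 | exists 0 => k _; exact: group1]. Qed.

Lemma gelM n (x y : nat -> G n) : gel x -> gel y -> gel (fun k => x k * y k).
Proof.
move=> [xP [M xM]] [yP [M' yM]]; split=> [k|]; first exact: groupM.
by exists (maxn M M') => k; rewrite geq_max => /andP[/xM xk /yM yk]; exact: groupM.
Qed.

Lemma gelV n (x : nat -> G n) : gel x -> gel (fun k => (x k)^-1).
Proof.
move=> [xP [M xM]]; split=> [k|]; first by rewrite groupV.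
by exists M => k /xM; rewrite groupV.
Qed.

Lemma gel_act m n (A : 'M['F_p]_(m, n)) x : gel x -> gel (fun k => act A (x k)).
Proof.
move=> [xP [M xM]]; split=> [k|]; first exact: subps_Phin.
by exists M => k /xM; apply: subps_Phin.
Qed.

Lemma gsub_gel : gsub (@gel p G).
Proof.
split=> //; [exact: gel1 | exact: gelM | exact: gelV | split=> //].
exact: gel_act.
Qed.

Lemma gsub_gzero : gsub (@gzero p G).
Proof.
split=> [n x [] //|n|n x y [gx x0] [gy y0]|n x [gx x0]|].
- by split; [exact: gel1 | move=> k; exact: group1].
- by split; [exact: gelM | move=> k; exact: groupM].
- by split; [exact: gelV | move=> k; rewrite groupV].
split=> [n x y [gx x0] gy xy|m n A x [gx x0]].
  by split=> // k; have := xy k; rewrite groupMl // groupV.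
by split=> [|k]; [exact: gel_act | exact: subps_Phin (x0 k)].
Qed.

Lemma gsub_zero (S : gpred) n x : gsub S -> gzero x -> S n x.
Proof.
move=> [_ S1 _ _ [Ssat _]] [gx x0].
by apply: Ssat (S1 n) gx _ => k; rewrite mul1g groupV.
Qed.

(** The sum of two subfunctors. No congruence is imposed on [w], since saturation of [A] absorbs a
    change of representative. *)
Definition gsum (A B : gpred) : gpred := fun n x =>
  gel x /\ exists2 w, B n w & A n (fun k => x k * (w k)^-1).

Lemma gsub_gsum A B : gsub A -> gsub B -> gsub (gsum A B).
Proof.
move=> [gA A1 AM AV [Asat Aact]] [gB B1 BM BV [_ Bact]]; split.
- by move=> n x [].
- move=> n; split; first exact: gel1; exists (fun _ => 1) => //.
  have := A1 n; congr A; apply: functional_extensionality => k.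
  by rewrite mulgV.
- move=> n x x' [gx [w Bw Aw]] [gx' [w' Bw' Aw']].
  split; first exact: gelM; exists (fun k => w k * w' k); first exact: BM.
  have [gw gw'] := (gB _ _ Bw, gB _ _ Bw').
  apply: Asat (AM _ _ _ Aw Aw') _ _ => [|k].
    by do ?apply: gelM => //; apply/gelV/gelM.
  have [d [rho [rM rV rK]]] := Phin_coords k n.
  have [xP x'P wP w'P] : [/\ x k \in Phin G k n, x' k \in Phin G k n,
     w k \in Phin G k n & w' k \in Phin G k n] by split; apply: gel_Phin.
  rewrite -rK ?(groupM, groupV) // !(rM, rV) ?(groupM, groupV) //.
  by rewrite addrACA -(opprD (rho (w k))) subrr.
- move=> n x [gx [w Bw Aw]]; split; first exact: gelV.
  exists (fun k => (w k)^-1); first exact: BV.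
  have gw := gB _ _ Bw; apply: Asat (AV _ _ Aw) _ _ => [|k].
    by apply: gelM; do ?apply: gelV.
  have [d [rho [rM rV rK]]] := Phin_coords k n.
  have [xP wP] : x k \in Phin G k n /\ w k \in Phin G k n by split; apply: gel_Phin.
  rewrite -rK ?(groupM, groupV) // !(rM, rV) ?(groupM, groupV) //.
  by rewrite -(opprD (rho (x k))) subrr.
- split=> [n x y [gx [w Bw Aw]] gy xy|m n C x [gx [w Bw Aw]]].
    split=> //; exists w => //; have gw := gB _ _ Bw.
    apply: Asat Aw _ _ => [|k]; first by apply: gelM => //; apply: gelV.
    by rewrite invMg invgK mulgA mulgKV.
  split; first exact: gel_act; exists (fun k => act C (w k)); first exact: Bact.
  have := Aact _ _ C _ Aw; congr A; apply: functional_extensionality => k.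
  by rewrite ps_actM ps_actV.
Qed.

Lemma gsum_inclr (A B : gpred) : gsub A -> gsub B -> gincl B (gsum A B).
Proof.
move=> [_ A1 _ _ _] [gB _ _ _ _] n x Bx; split; first exact: gB Bx.
exists x => //; have := A1 n; congr A.
by apply: functional_extensionality => k; rewrite mulgV.
Qed.

Lemma gsum_incll (A B : gpred) : gsub A -> gsub B -> gincl A (gsum A B).
Proof.
move=> [gA _ _ _ _] [_ B1 _ _ _] n x Ax; split; first exact: gA Ax.
exists (fun _ => 1) => //; have := Ax; congr A.
by apply: functional_extensionality => k; rewrite invg1 mulg1.
Qed.

Lemma gsum_min (A B C : gpred) : gsub C -> gincl A C -> gincl B C -> gincl (gsum A B) C.
Proof.
move=> [_ _ CM _ _] AC BC n x [_ [w /BC Cw /AC Cx]].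
have := CM _ _ _ Cx Cw; congr C.
by apply: functional_extensionality => k; rewrite mulgKV.
Qed.

Lemma simple_layer (S S' B : gpred) :
  gsub S -> gsub S' -> gsub B -> gincl S' S -> gincl B S ->
  (forall T, gsub T -> gincl S' T -> gincl T S -> Defs.geq T S' \/ Defs.geq T S) ->
  gincl B S' \/ gincl S (gsum S' B).
Proof.
move=> sS sS' sB S'S BS simp.
have [||e|e] := simp _ (gsub_gsum sS' sB); first exact: gsum_incll.
- exact: gsum_min.
- by left=> n x /(gsum_inclr sS' sB) /e.
- by right=> n x /e.
Qed.

Lemma gsubI (A B : gpred) : gsub A -> gsub B -> gsub (fun n x => A n x /\ B n x).
Proof.
move=> [gA A1 AM AV [Asat Aact]] [gB B1 BM BV [Bsat Bact]]; split=> //.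
- by move=> n x [/gA].
- by move=> n x y [? ?] [? ?]; split; [exact: AM | exact: BM].
- by move=> n x [? ?]; split; [exact: AV | exact: BV].
split=> [n x y [Ax Bx] gy xy|m n C x [Ax Bx]]; split.
- exact: Asat Ax gy xy.
- exact: Bsat Bx gy xy.
- exact: Aact.
- exact: Bact.
Qed.

Definition gfam (M : nat -> family) : gpred := fun n x => gel x /\ forall k, x k \in M k n.

Lemma gsub_gfam (M : nat -> family) :
  (forall k, subps (M k)) -> (forall k n, Phin G k.+1 n \subset M k n) -> gsub (gfam M).
Proof.
move=> sM PM; split.
- by move=> n x [].
- by move=> n; split; [exact: gel1 | move=> k; exact: group1].
- by move=> n x y [gx xM] [gy yM]; split; [exact: gelM | move=> k; exact: groupM].
- by move=> n x [gx xM]; split; [exact: gelV | move=> k; rewrite groupV].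
split=> [n x y [gx xM] gy xy|m n A x [gx xM]].
  by split=> // k; have := subsetP (PM k n) _ (xy k); rewrite groupMl // groupV.
by split=> [|k]; [exact: gel_act | exact: sM (xM k)].
Qed.

(** The part of degree at least [i]; in lower degrees [Phin G k.+1] represents zero. *)
Definition gtail i : gpred := gfam (fun k => if k < i then Phin G k.+1 else Phin G k).

Lemma gsub_gtail i : gsub (gtail i).
Proof.
apply: gsub_gfam => k; case: ifP => _; try exact: subps_Phin; move=> n //.
exact: Phin_subS.
Qed.

Definition gsingle n i (y : G n) : nat -> G n := fun k => if k == i then y else 1.

Lemma gel_single n i (y : G n) : y \in Phin G i n -> gel (gsingle i y).
Proof.
move=> yP; split=> [k|]; first by rewrite /gsingle; case: eqP => [->|].
by exists i.+1 => k ltik; rewrite /gsingle gtn_eqF.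
Qed.

(** The tails must disappear from each of the finitely many simple layers, so some tail is zero.
    Then [Phin G i] equals its own Frattini subgroup and is trivial. *)
Lemma p_finite_Phin : p_finite G -> exists i, eqfam (Phin G i) (@botfam p G).
Proof.
move=> [N [S [S0 SN sS simS]]].
(* A simple layer is nonzero at some [F_p^m], where all far tails vanish. Such a tail cannot
   generate the layer, hence contributes nothing to it. *)
have layer j : j < N -> exists m, forall i, m <= i ->
    forall n x, gtail i x -> S j n x -> S j.+1 n x.
  move=> ltjN; have [SS [m [x0 [x0S x0S']]] simSj] := simS j ltjN.
  have [k Phik] := Phin_eq1 G m; exists k => i leki n x tx Sx.
  have sSj := sS j (ltnW ltjN); have sSj1 := sS j.+1 ltjN.
  have sB := gsubI (gsub_gtail i) sSj.
  have [|BS|BS] := simple_layer sSj sSj1 sB SS _ simSj; first by move=> ? ? [].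
    by apply: BS.
  have [_ [w [[gw wt] _] Sw]] := BS _ _ x0S; case: x0S'.
  have [_ _ SM _ _] := sSj1.
  have w0 : gzero w.
    split=> // l; have := wt l; case: ltnP => // leil.
    by move/(subsetP (Phin_sub G m (leq_trans leki leil))); rewrite Phik => /set1gP ->.
  have := SM _ _ _ Sw (gsub_zero sSj1 w0); congr S.
  by apply: functional_extensionality => l; rewrite mulgKV.
have [i ti] : exists i, forall n x, gtail i x -> S N n x.
  have := leqnn N; elim: {1 3}N => [|j IHj] ltjN; first by exists 0 => n x [/S0].
  have [i1 t1] := IHj (ltnW ltjN); have [i2 t2] := layer j ltjN.
  exists (maxn i1 i2) => n x tx; apply: t2 (tx) _; first exact: leq_maxr.
  apply: t1; have [gx xt] := tx; split=> // k; have := xt k.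
  case: (ltnP k i1) => [ltk1|_]; first by rewrite leq_max ltk1.
  by case: ifP => // _; apply/subsetP/Phin_subS.
exists i => n; apply: Phin_stable; apply/subsetP => y yP.
have /ti/SN[_ /(_ i)] : gtail i (gsingle i y).
  split=> [|k]; first exact: gel_single.
  by rewrite /gsingle; case: eqP => [->|]; rewrite ?ltnn //; case: ifP.
by rewrite /gsingle eqxx.
Qed.

Section Slices.

Variables (S : gpred) (i : nat).

Definition slice_set n : {set G n} := [set y in Phin G i n | decb (S (gsingle i y))].

(** The degree [i] component of [S]. Taking the generated subgroup gives a group for any predicate;
    for a subfunctor it adds nothing, by [sliceP]. *)
Definition slice : family := fun n => <<slice_set n>>%G.

Hypothesis sS : gsub S.

Lemma sliceP n (y : G n) :
  reflect (y \in Phin G i n /\ S (gsingle i y)) (y \in slice n).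
Proof.
have setP x : reflect (x \in Phin G i n /\ S (gsingle i x)) (x \in slice_set n).
  rewrite inE; apply: (iffP andP) => [[xP /decbP]|[xP Sx]]; split=> //.
  exact/decbP.
rewrite /= gen_set_id //; have [_ S1 SM _ _] := sS; apply/group_setP; split=> [|x z].
  apply/setP; split; first exact: group1.
  have := S1 n; congr S; apply: functional_extensionality => k.
  by rewrite /gsingle if_same.
move=> /setP[xP Sx] /setP[zP Sz]; apply/setP; split; first exact: groupM.
have := SM _ _ _ Sx Sz; congr S; apply: functional_extensionality => k.
by rewrite /gsingle; case: eqP => // _; rewrite mulg1.
Qed.

Lemma subps_slice : subps slice.
Proof.
have [_ _ _ _ [_ Sact]] := sS.
move=> m n A x /sliceP[xP Sx]; apply/sliceP; split; first exact: subps_Phin.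
have := Sact _ _ A _ Sx; congr S; apply: functional_extensionality => k.
by rewrite /gsingle; case: eqP => // _; rewrite ps_act_one.
Qed.

Lemma Phin_slice n : Phin G i.+1 n \subset slice n.
Proof.
apply/subsetP => y yP; have yP' := subsetP (Phin_subS G i n) y yP.
apply/sliceP; split=> //; apply: (gsub_zero sS).
split=> [|k]; first exact: gel_single.
by rewrite /gsingle; case: eqP => [->|].
Qed.

Lemma slice_Phin n : slice n \subset Phin G i n.
Proof. by apply/subsetP => y /sliceP[]. Qed.

End Slices.

(** An intermediate [M], placed in degree [i] with zero elsewhere, is a subfunctor of [S].
    Simplicity puts it inside [S'] or makes it span [S] together with [S'], and degree [i] is then
    read off. *)
Lemma simple_slice (S S' : gpred) i (M : family) :
  gsub S -> gsub S' -> gincl S' S ->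
  (forall T, gsub T -> gincl S' T -> gincl T S -> Defs.geq T S' \/ Defs.geq T S) ->
  subps M -> (forall n, slice S' i n \subset M n) ->
  (forall n, M n \subset slice S i n) ->
  eqfam M (slice S' i) \/ eqfam M (slice S i).
Proof.
move=> sS sS' S'S simp sM S'M MS.
have MP n y : y \in M n -> y \in Phin G i n /\ S n (gsingle i y).
  by move/(subsetP (MS n))/(sliceP _ sS).
pose B := gfam (fun k => if k == i then M else Phin G k.+1).
have sB : gsub B.
  apply: gsub_gfam => k; case: eqP => [e|_] //; first exact: subps_Phin.
  by move=> n; rewrite e; apply: subset_trans (Phin_slice i sS' n) (S'M n).
have BS : gincl B S.
  move=> n w [gw wB]; have := wB i; rewrite eqxx => /MP[wP Sw].
  have [_ _ _ _ [Ssat _]] := sS; apply: Ssat Sw gw _ => k.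
  have := wB k; rewrite /gsingle; case: eqP => [->|_] wk; first by rewrite mulgV group1.
  by rewrite mul1g groupV.
have [BS'|SB] := simple_layer sS sS' sB S'S BS simp; [left|right] => n; apply/eqP;
  rewrite eqEsubset ?S'M ?MS ?andbT //=.
  apply/subsetP => y yM; have [yP _] := MP _ _ yM; apply/(sliceP _ sS'); split=> //.
  apply: BS'; split; first exact: gel_single.
  by move=> k; rewrite /gsingle; case: eqP.
apply/subsetP => y /(sliceP _ sS)[yP /SB[_ [w [gw wB] Sw]]].
have := wB i; rewrite eqxx => wiM; rewrite -(groupMr _ (groupVr wiM)).
have yw : y * (w i)^-1 \in Phin G i n by rewrite groupM ?groupV //; apply: gel_Phin.
apply: (subsetP (S'M n)); apply/(sliceP _ sS'); split=> //.
have [_ _ _ _ [S'sat _]] := sS'; apply: S'sat Sw (gel_single yw) _ => k.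
have := wB k; rewrite /gsingle; case: eqP => [->|_] wk; first by rewrite mulgV group1.
by rewrite mul1g invg1 mulg1 groupV.
Qed.

Lemma p_finite_cross_vanish : p_finite G -> exists n, cross_vanish G n.
Proof.
move=> pfG; have [I PhiI] := p_finite_Phin pfG.
have [N [S [S0 SN sS simS]]] := pfG.
apply: cross_into_vanish; apply: (cross_into_eqfam (H := Phin G 0)) PhiI _ => //.
(* For each [i], the degree [i] slices of the composition series form a chain from [Phin G i] to
   [Phin G i.+1]; steps with equal ends are harmless. *)
apply: cross_into_chain => i _; pose L j := slice (S j) i.
have L0 : eqfam (L 0) (Phin G i).
  move=> n; apply/eqP; rewrite eqEsubset slice_Phin; last exact: sS.
  apply/subsetP => y yP; apply/sliceP; first exact: sS.
  by split=> //; apply/S0/gel_single.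
have LN : eqfam (L N) (Phin G i.+1).
  move=> n; apply/eqP; rewrite eqEsubset Phin_slice ?andbT; last exact: sS.
  apply/subsetP => y /sliceP[|_ /SN[_ /(_ i)]]; first exact: sS.
  by rewrite /gsingle eqxx.
apply: (cross_into_eqfam L0 LN); apply: cross_into_chain => j ltjN.
have [SS _ simSj] := simS j ltjN.
have sSj := sS j (ltnW ltjN); have sSj1 := sS j.+1 ltjN.
apply: (simple_section hp); try exact: subps_slice.
- move=> n; apply/subsetP => y /(sliceP _ sSj1)[yP /SS Sy].
  exact/(sliceP _ sSj).
- move=> n; apply: subset_trans (Phin_slice i sSj1 n).
  exact: PhiS (pgroup_Phin G i n) (slice_Phin i sSj n).
- move=> M sM sLM nML; apply: (simple_slice sSj sSj1 SS simSj) => // n.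
  exact: normal_sub.
Qed.

(** The word expressing the identity acts degree by degree, and a subfunctor is closed under the
    operations it uses. *)
Lemma gdetection n t (S : gpred) (x : nat -> G t) :
  cross_vanish G n -> gsub S -> gel x ->
  (forall f, S n (fun k => act (sel p f : 'M_(n, t)) (x k))) -> S t x.
Proof.
move=> /(@natop_id p G n t) nG [_ S1 SM SV [_ Sact]] gx xS.
change (S t (fun k => id (x k))).
elim: nG => [U /(@dg_factor p)[A [f ->]]||f g _ IHf _ IHg|f _ IHf].
- have := Sact _ _ A _ (xS f); congr S; apply: functional_extensionality => k.
  by rewrite ps_actC.
- exact: S1.
- exact: SM IHf IHg.
- exact: SV IHf.
Qed.

Lemma cross_vanish_p_finite n : cross_vanish G n -> p_finite G.
Proof.
move=> vG; have [N PhiN] := cross_vanish_Phin vG.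
(* Since [Phin G N] is trivial, a representative is [1] from degree [N] on. The value of a
   subfunctor at [F_p^n] is thus encoded by a finite set, whose cardinal is the measure for
   [chain_exists]. *)
pose ext (f : {ffun 'I_N -> G n}) k : G n := if insub k is Some i then f i else 1.
have extK (x : nat -> G n) : gel x -> ext [ffun i : 'I_N => x i] = x.
  move=> gx; apply: functional_extensionality => k; rewrite /ext.
  case: insubP => [i _ <-|]; first by rewrite ffunE.
  rewrite -leqNgt => leNk; symmetry; apply/set1gP.
  have := gel_Phin k gx => /(subsetP (Phin_sub G n leNk)).
  by rewrite (PhiN n).
pose mset (S : gpred) := [set f | decb (S n (ext f))].
have msetS (S T : gpred) : gincl S T -> mset S \subset mset T.
  by move=> ST; apply/subsetP => f; rewrite !inE => /decbP/ST/decbP.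
have [] := @chain_exists _ (@gsub p G) (@gincl p G) (@gincl p G) (@Defs.geq p G)
  (fun S => #|mset S|) (@gzero p G) _ _ _ _ _ _ gsub_gzero _ (@gel p G) gsub_gel _.
- by move=> S T e m x; split=> /e.
- by move=> S m x.
- by [].
- by move=> S1 S2 S3 s12 s23 m x /s12/s23.
- by move=> S T _ _ ST; apply/subset_leq_card/msetS.
- move=> S T sS sT ST leTS t x; split=> [/ST//|Tx].
  have eST : mset S = mset T by apply/eqP; rewrite eqEcard msetS.
  have [gT _ _ _ [_ Tact]] := sT.
  apply: (gdetection vG sS (gT _ _ Tx)) => f.
  pose y k := act (sel p f : 'M_(n, t)) (x k).
  have Ty : T n y by apply: Tact.
  have gy := gT _ _ Ty; change (S n y); rewrite -(extK y gy); apply/decbP.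
  suff: [ffun i : 'I_N => y i] \in mset S by rewrite inE.
  by rewrite eST inE extK //; apply/decbP.
- by [].
- by move=> m x [].
move=> M [L [L0 LM sL simL]]; exists M, L; split=> // [|j ltjM]; first by rewrite L0.
have [LL nL simLj] := simL j ltjM; split=> //.
apply: NNPP => nex; apply: nL => m x; split=> [/LL//|Lx].
by apply: NNPP => nLx; apply: nex; exists m, x.
Qed.

End GradedFunctor.

Theorem theorem8p7 (p : nat) (hp : prime p) (G : presheaf p) :
  [/\ p_finite G <-> is_polynomial G,
      is_polynomial G <-> cond3 G,
      cond3 G <-> comp_series G,
      comp_series G <-> growth_poly_bounded G &
      (forall n, abelian [set: G n]) ->
        (p_finite G <-> finite_section (topfam G) (botfam G))].
Proof.
pose V := exists n, cross_vanish G n.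
have e1 : p_finite G <-> V.
  by split=> [/(p_finite_cross_vanish hp)|[n /cross_vanish_p_finite]].
have e2 : is_polynomial G <-> V.
  split=> -[n]; [move/poly_deg_le_cross_vanish | move/cross_vanish_poly_deg_le];
    by exists n.
have e3 : cond3 G <-> V.
  by split=> [/(cond3_cross_vanish hp)|[n /cross_vanish_cond3]].
have e4 : comp_series G <-> V.
  by split=> [/(comp_series_cross_vanish hp)|[n /cross_vanish_comp_series]].
have e5 : growth_poly_bounded G <-> V.
  by split=> [/growth_cross_vanish|[n /(cross_vanish_growth hp)]].
split=> [||||abG]; try tauto; split=> [/e1[n vG]|]; last first.
  by move/(finite_section_comp_series abG)/e4/e1.
apply: (cross_vanish_finite_section vG); [exact: subps_top | exact: subps_bot|].
by move=> t; apply: sub1G.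
Qed.
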